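(* Let $X$ be a paracompact complex manifold with a locally finite Stein open cover $\mathcal{U}=\{U_\alpha\}$ all of whose finite intersections are Stein, and let $E$ be a holomorphic vector bundle on $X$ trivialised by $\mathcal{U}$, with flat holomorphic connections $\nabla_\alpha$ on $E|_{U_\alpha}$. Then, for each $k$, the degree-$(k,k)$ term in the trace of the fibre integral of the $k$-th simplicial exponential Atiyah class $\hat{\mathrm{at}}_E^{\circ k}$ (defined with the barycentric connection) agrees with the trace of the $k$-th exponential Atiyah class $\mathrm{at}_E^{\circ k}$ up to skew-symmetrisation, i.e. $$\varsigma_k\left(\operatorname{tr}\int_{\Delta^\bullet}\hat{\mathrm{at}}_E^{\circ k}\right)^{(k,k)}=\varsigma_k\operatorname{tr}\left(\mathrm{at}_E^{\circ k}\right)\in\check{\mathscr{C}}^k_{\mathcal{U}}(\Omega_X^k).$$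
   Context: Čech nerve: $X_p^{\mathcal U}=\bigsqcup_{(\alpha_0,\dots,\alpha_p)}U_{\alpha_0\cdots\alpha_p}$. $\check{\mathscr{C}}^p_{\mathcal U}(\Omega_X^q)=\Gamma(X_p^{\mathcal U},\Omega^q)$ are Čech cochains (not assumed skew-symmetric) with values in holomorphic forms. Atiyah cocycles: $\omega_{\alpha\beta}=\nabla_\beta-\nabla_\alpha\in\Gamma(U_{\alpha\beta},\mathcal{E}nd(E)\otimes\Omega_X^1)$. The product of endomorphism-valued forms is composition on endomorphisms and wedge product on forms. The $k$-th exponential Atiyah class is represented by $(\mathrm{at}_E^{\circ k})_{\alpha_0\cdots\alpha_k}=\omega_{\alpha_0\alpha_1}\omega_{\alpha_1\alpha_2}\cdots\omega_{\alpha_{k-1}\alpha_k}$, all factors being regarded as sections of $\mathcal{E}nd(E)\otimes\Omega^1_X$ over $U_{\alpha_0\cdots\alpha_k}$ (in matrix terms: base-changed to the $U_{\alpha_0}$ trivialisation); $\operatorname{tr}\mathrm{at}_E^{\circ k}$ denotes the trace of this cocycle. Simplicial forms: forms on $X_p^{\mathcal U}\times\Delta^p$ are sums of forms $\xi\otimes\tau$ with $\xi$ a holomorphic form in the $X_p^{\mathcal U}$-direction (with coefficients depending smoothly on $\Delta^p$) and $\tau$ a smooth form on $\Delta^p$; such a form has type $(|\xi|,|\tau|)$. The differential is $\mathrm{d}(\xi\otimes\tau)=\mathrm{d}\xi\otimes\tau+(-1)^{|\xi|}\xi\otimes\mathrm{d}\tau$ and products follow the Koszul rule $(\xi\otimes\tau)(\xi'\otimes\tau')=(-1)^{|\tau||\xi'|}\xi\xi'\otimes\tau\tau'$.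 A simplicial $r$-form is a family $(\omega_p)_{p}$ of $r$-forms on $X_p^{\mathcal U}\times\Delta^p$ whose pullbacks agree along the coface maps. Let $t_0,\dots,t_p$ be barycentric coordinates on $\Delta^p$, with $t_0=1-t_1-\dots-t_p$, and orient $\Delta^p$ by $\mathrm{d}t_1\cdots\mathrm{d}t_p$. Fibre integration: for a simplicial $r$-form, $\int_{\Delta^\bullet}$ has values in $\bigoplus_p\Omega^{r-p}(X_p^{\mathcal U})=\mathrm{Tot}^r\check{\mathscr C}^\bullet(\Omega_X^\star)$; its Čech degree $p$ component is $(-1)^{(r-p)p}$ times the integral over $\Delta^p$ of the type-$(r-p,p)$ part of the form on $X_p^{\mathcal U}\times\Delta^p$, where $\int_{\Delta^p}\xi\otimes f\,\mathrm{d}t_1\cdots\mathrm{d}t_p=\xi\int_{\Delta^p} f\,\mathrm{d}t_1\cdots\mathrm{d}t_p$. The exponent $(k,k)$ denotes the component in Čech degree $k$ and form degree $k$. Integration is applied to endomorphism-valued forms entrywise and commutes with the trace. Barycentric connection: let $\overline{E^p}$ be the pullback of $E$ to $X_p^{\mathcal U}\times\Delta^p$. Over $U_{\alpha_0\cdots\alpha_p}\times\Delta^p$ set $\nabla_p^\mu=\sum_{i=0}^pt_i\nabla_{\alpha_i}=\nabla_{\alpha_0}+\sum_{i=1}^pt_i\omega_{\alpha_0\alpha_i}$. With respect to a $\nabla_{\alpha_0}$-flat frame, its curvature is $\kappa(\nabla_p^\mu)=\mathrm{d}\overline\omega_p+\overline\omega_p\cdot\overline\omega_p$, where $\overline\omega_p=\sum_{i=1}^pt_i\omega_{\alpha_0\alpha_i}$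 and so $\mathrm{d}\overline\omega_p=\sum_i t_i\mathrm{d}\omega_{\alpha_0\alpha_i}-\sum_i\omega_{\alpha_0\alpha_i}\otimes\mathrm{d}t_i$. The $k$-th simplicial exponential Atiyah class is $\hat{\mathrm{at}}_E^{\circ k}=\{\epsilon_k\,\kappa(\nabla_p^\mu)^k\}_{p}$ with $\epsilon_k=(-1)^{k(k-1)/2}$. Skew-symmetrisation of a Čech $p$-cochain $c$: $(\varsigma_pc)_{\alpha_0\cdots\alpha_p}=\frac1{(p+1)!}\sum_{\sigma\in S_{p+1}}\mathrm{sgn}(\sigma)\,c_{\alpha_{\sigma(0)}\cdots\alpha_{\sigma(p)}}$, where $S_{p+1}$ is the group of permutations of $\{0,\dots,p\}$. *)

(* Defs.v *)
From HB Require Import structures.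
From mathcomp Require Import all_boot all_order all_algebra all_fingroup.
From mathcomp Require Import complex.
From mathcomp Require Import all_classical all_reals all_analysis.

Set Implicit Arguments.
Unset Strict Implicit.
Unset Printing Implicit Defensive.

Import Order.TTheory GRing.Theory Num.Theory.
Import numFieldNormedType.Exports.

Local Open Scope classical_set_scope.
Local Open Scope ring_scope.

(* Naming R[i] at this type makes the normed-module structures of
   numFieldNormedType (hence complex differentiability) available on it. *)
Definition CC (R : realType) : numClosedFieldType := R[i].

Section Topology.
Variable X : topologicalType.

Definition is_open_cover (I : Type) (D : set I) (F : I -> set X) : Prop :=
  (forall i, D i -> open (F i)) /\ \bigcup_(i in D) F i = setT.

Definition locally_finite (I : Type) (D : set I) (F : I -> set X) : Prop :=
  forall x : X, exists2 N, nbhs x N & finite_set [set i | D i /\ F i `&` N !=set0].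

Definition paracompact : Prop :=
  forall D : set (set X), is_open_cover D id ->
  exists D' : set (set X), [/\ is_open_cover D' id, locally_finite D' id &
    forall W, D' W -> exists2 V, D V & W `<=` V].

End Topology.

Record chart (R : realType) (n : nat) (X : topologicalType) := Chart {
  cdom : set X;
  cmap : X -> 'rV[CC R]_n;
  cinv : 'rV[CC R]_n -> X;
  cdom_open : open cdom;
  cimg_open : open (cmap @` cdom);
  cmapK : forall x, cdom x -> cinv (cmap x) = x;
  cmap_continuous : forall x, cdom x -> {for x, continuous cmap};
  cinv_continuous : forall y, (cmap @` cdom) y -> {for y, continuous cinv} }.

Record complex_manifold (R : realType) (n : nat) := ComplexManifold {
  points :> topologicalType;
  chart_idx : Type;
  charts : chart_idx -> chart R n points;
  points_hausdorff : hausdorff_space points;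
  charts_cover : forall x, exists c, cdom (charts c) x;
  charts_holomorphic : forall c c' x,
    cdom (charts c) x -> cdom (charts c') x ->
    differentiable (cmap (charts c') \o cinv (charts c)) (cmap (charts c) x) }.

Section Manifold.
Variables (R : realType) (n : nat) (X : complex_manifold R n).
Implicit Types (U : set X) (c : chart_idx X).

Definition in_chart c (x : X) : Prop := cdom (charts c) x.
Definition coords c (x : X) : 'rV[CC R]_n := cmap (charts c) x.
Definition local_expr (T : Type) c (f : X -> T) : 'rV[CC R]_n -> T :=
  f \o cinv (charts c).

Definition holo_fun U (f : X -> CC R) : Prop :=
  forall c x, U x -> in_chart c x -> differentiable (local_expr c f) (coords c x).

Definition chart_deriv c (f : X -> CC R) (x : X) (v : 'rV[CC R]_n) : CC R :=
  'D_v (local_expr c f) (coords c x).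

Definition tangent_map c c' (x : X) : 'rV[CC R]_n -> 'rV[CC R]_n :=
  'd (local_expr c (coords c')) (coords c x).

Definition holo_hull U (K : set X) : set X :=
  [set x | U x /\ forall f, holo_fun U f ->
     forall M : CC R, (forall y, K y -> `|f y| <= M) -> `|f x| <= M].

Definition stein U : Prop :=
  [/\ open U,
      forall K, compact K -> K `<=` U -> compact (holo_hull U K),
      forall x y, U x -> U y -> x <> y -> exists2 f, holo_fun U f & f x <> f y
    & forall x c, U x -> in_chart c x ->
        exists2 f : 'I_n -> X -> CC R, forall i, holo_fun U (f i) &
          \matrix_(i, j) chart_deriv c (f j) x (delta_mx 0 i) \in unitmx].

(* A form of mixed degree, given by its expression in every chart: its degree-q
   component at x, read in the chart c, is the restriction of [w c x] to lists
   of q tangent vectors.  Values at points outside the domain of the chart or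
   outside the open set under consideration are irrelevant. *)
Definition form (T : Type) := chart_idx X -> X -> seq 'rV[CC R]_n -> T.

Definition holo_form U (q : nat) (w : form (CC R)) : Prop :=
  forall c x, U x -> in_chart c x ->
  [/\ forall s, size s != q -> w c x s = 0,
      forall s1 s2 (a : CC R) u v,
        w c x (s1 ++ (a *: u + v) :: s2) =
        a * w c x (s1 ++ u :: s2) + w c x (s1 ++ v :: s2),
      forall s1 s2 s3 u, w c x (s1 ++ u :: s2 ++ u :: s3) = 0,
      forall s, differentiable (local_expr c (fun y => w c y s)) (coords c x)
    & forall c' s, in_chart c' x -> w c' x (map (tangent_map c c' x) s) = w c x s].

End Manifold.

(* (-1) to the number of pairs i < j with j selected by m and i not: the sign of
   the shuffle that moves the selected positions in front of the others. *)
Definition shuffle_sign (K : pzRingType) (q : nat) (m : q.-tuple bool) : K :=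
  (-1) ^+ #|[set ij : 'I_q * 'I_q |
             [&& (ij.1 < ij.2)%N, ~~ tnth m ij.1 & tnth m ij.2]]|.

Definition omit (T : Type) (i : nat) (s : seq T) : seq T :=
  take i s ++ drop i.+1 s.

Section EndForms.
Variables (R : realType) (n : nat) (X : complex_manifold R n) (r : nat).

Definition eform := form X 'M[CC R]_r.

Definition eone : eform := fun _ _ s => if s is [::] then 1%:M else 0.

Definition eprod (w w' : eform) : eform := fun c x s =>
  \sum_(m : (size s).-tuple bool)
    shuffle_sign (CC R) m *: (w c x (mask m s) *m w' c x (mask (map negb m) s)).

Definition ediff (w : eform) : eform := fun c x s =>
  \matrix_(a, b) \sum_(i < size s)
    (-1) ^+ i * chart_deriv c (fun y => w c y (omit i s) a b) x (nth 0 s i).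

(* Multiplication of the degree-q component by (-1)^(p q). *)
Definition esign (p : nat) (w : eform) : eform := fun c x s =>
  (-1) ^+ (p * size s) *: w c x s.

Definition etrace (w : eform) : form X (CC R) := fun c x s => \tr (w c x s).

(* [M t w c x s] is the value of the form at the point (x, t) on the tangent
   vectors s of X and w of Delta^p, where t = (t_1, ..., t_p), in such a way that
   (xi (x) tau)(s, w) = xi(s) tau(w).  The component of type (a, b) is the
   restriction to size s = a and size w = b. *)
Definition mform (p : nat) := 'rV[R]_p -> seq 'rV[R]_p -> eform.

Definition mone p : mform p := fun _ w =>
  if w is [::] then eone else fun _ _ _ => 0.

(* The [esign] is the Koszul sign (-1)^(|tau| |xi'|). *)
Definition mprod p (M N : mform p) : mform p := fun t w c x s =>
  \sum_(m : (size w).-tuple bool)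
    shuffle_sign (CC R) m *:
      eprod (M t (mask m w))
            (esign (count id m) (N t (mask (map negb m) w))) c x s.

Definition real_deriv p (f : 'rV[R]_p -> CC R) (t v : 'rV[R]_p) : CC R :=
  Complex ('D_v (fun u => complex.Re (f u)) t) ('D_v (fun u => complex.Im (f u)) t).

Definition mdiff_simplex p (M : mform p) : mform p := fun t w c x s =>
  \matrix_(a, b) \sum_(j < size w)
    (-1) ^+ j * real_deriv (fun u => M u (omit j w) c x s a b) t (nth 0 w j).

Definition mdiff p (M : mform p) : mform p := fun t w c x s =>
  ediff (M t w) c x s + esign 1 (mdiff_simplex M t w) c x s.

End EndForms.

(* The integral of f over {t | 0 <= t_i, t_1 + ... + t_p <= b}, as an iterated
   Lebesgue integral. *)
Fixpoint simplex_int (R : realType) (p : nat) (b : R) {struct p} :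
    ('rV[R]_p -> R) -> R :=
  match p return ('rV[R]_p -> R) -> R with
  | 0 => fun f => f 0
  | p'.+1 => fun f =>
      \int[lebesgue_measure]_(x in `[0, b])
        simplex_int (b - x) (fun t : 'rV[R]_p' => f (row_mx (x%:M : 'M[R]_1) t))
  end.

Definition simplex_intC (R : realType) (p : nat) (f : 'rV[R]_p -> CC R) : CC R :=
  Complex (simplex_int 1 (fun t => complex.Re (f t)))
          (simplex_int 1 (fun t => complex.Im (f t))).

Definition barycentric (R : realType) (p : nat) (t : 'rV[R]_p) (i : 'I_p.+1) : R :=
  if unlift ord0 i is Some j then t 0 j else 1 - \sum_(j < p) t 0 j.

Record holo_bundle (R : realType) (n : nat) (X : complex_manifold R n) (r : nat) :=
  HoloBundle {
  fib :> X -> vectType (CC R);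
  triv_idx : Type;
  triv_dom : triv_idx -> set X;
  triv_frame : triv_idx -> forall x, r.-tuple (fib x);
  triv_open : forall i, open (triv_dom i);
  triv_cover : forall x, exists i, triv_dom i x;
  triv_basis : forall i x, triv_dom i x -> basis_of fullv (triv_frame i x);
  triv_holomorphic : forall i j (a b : 'I_r),
    holo_fun (triv_dom i `&` triv_dom j)
      (fun x => coord (triv_frame i x) a (tnth (triv_frame j x) b)) }.

Section Bundle.
Variables (R : realType) (n : nat) (X : complex_manifold R n) (r : nat).
Variable E : holo_bundle X r.
Implicit Types (U V : set X).

Definition holo_section V (s : forall x, E x) : Prop :=
  forall i (a : 'I_r),
    holo_fun (V `&` triv_dom i) (fun x => coord (triv_frame i x) a (s x)).

Definition Eform1 := chart_idx X -> forall x, 'rV[CC R]_n -> E x.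

Definition holo_Eform1 V (w : Eform1) : Prop :=
  forall i (a : 'I_r),
    holo_form (V `&` triv_dom i) 1 (fun c x s =>
      if s is [:: v] then coord (triv_frame i x) a (w c x v) else 0).

(* A morphism of sheaves E -> E (x) Omega^1 over U.  Sections over V are
   represented by arbitrary families s, only the values on V being meaningful;
   [nabla_local] says that nabla s on V depends only on s on V, and is thus both
   well-definedness and compatibility with restriction. *)
Record holo_connection U := HoloConnection {
  nabla :> (forall x, E x) -> Eform1;
  nabla_holo : forall V s, open V -> V `<=` U ->
    holo_section V s -> holo_Eform1 V (nabla s);
  nabla_local : forall V s s', open V -> V `<=` U ->
    holo_section V s -> holo_section V s' -> (forall x, V x -> s x = s' x) ->
    forall c x v, V x -> in_chart c x -> nabla s c x v = nabla s' c x v;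
  nabla_add : forall V s s', open V -> V `<=` U ->
    holo_section V s -> holo_section V s' ->
    forall c x v, V x -> in_chart c x ->
      nabla (fun y => s y + s' y) c x v = nabla s c x v + nabla s' c x v;
  nabla_leibniz : forall V f s, open V -> V `<=` U ->
    holo_fun V f -> holo_section V s ->
    forall c x v, V x -> in_chart c x ->
      nabla (fun y => f y *: s y) c x v =
      chart_deriv c f x v *: s x + f x *: nabla s c x v }.

Definition frame := forall x, r.-tuple (E x).

Definition holo_frame V (e : frame) : Prop :=
  (forall j, holo_section V (fun x => tnth (e x) j)) /\
  (forall x, V x -> basis_of fullv (e x)).

(* nabla e_j = \sum_i e_i (x) theta_ij *)
Definition conn_matrix U (e : frame) (D : holo_connection U) : eform X r :=
  fun c x s => if s is [:: v] then
    \matrix_(i, j) coord (e x) i (D (fun y => tnth (e y) j) c x v) else 0.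

Definition flat U (D : holo_connection U) : Prop :=
  forall V (e : frame), open V -> V `<=` U -> holo_frame V e ->
  forall c x s, V x -> in_chart c x ->
    ediff (conn_matrix e D) c x s +
    eprod (conn_matrix e D) (conn_matrix e D) c x s = 0.

End Bundle.

Section Cech.
Variables (R : realType) (n : nat) (X : complex_manifold R n).
Variables (A : Type) (U : A -> set X).

Definition inter p (al : 'I_p.+1 -> A) : set X := \bigcap_i U (al i).

(* Not necessarily skew-symmetric; only values over U_{al 0 ... al p} matter. *)
Definition cochain (T : Type) (p : nat) := ('I_p.+1 -> A) -> form X T.

Definition cech_space p q (b : cochain (CC R) p) : Prop :=
  forall al, holo_form (inter al) q (b al).

Definition cochain_eq p (b b' : cochain (CC R) p) : Prop :=
  forall al c x s, inter al x -> in_chart c x -> b al c x s = b' al c x s.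

Definition cech_skew p (b : cochain (CC R) p) : cochain (CC R) p := fun al c x s =>
  (p.+1)`!%:R^-1 * \sum_(sg : 'S_p.+1) (-1) ^+ sg * b (al \o sg) c x s.

(* The component of Cech degree p and form degree q of an element of Tot. *)
Definition bidegree p q (b : forall p, cochain (CC R) p) : cochain (CC R) p :=
  fun al c x s => if size s == q then b p al c x s else 0.

Variable r : nat.

(* The sign is (-1)^((r - p) p) in total degree r, since r - p is the degree in
   the X-direction; evaluating on the coordinate vector fields d/dt_1, ..., d/dt_p
   extracts the coefficient of dt_1 ... dt_p. *)
Definition fibre_int (F : forall p, ('I_p.+1 -> A) -> mform X r p) :
    forall p, cochain 'M[CC R]_r p := fun p al =>
  esign p (fun c x s => \matrix_(a, b) simplex_intC (fun t =>
    F p al t [seq delta_mx 0 j | j <- enum 'I_p] c x s a b)).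

Variables (E : holo_bundle X r) (e : A -> frame E).
Variable D : forall a, holo_connection E (U a).

(* omega_{a b} = nabla_b - nabla_a, as a matrix in the frame e_g. *)
Definition omega (g a b : A) : eform X r := fun c x s =>
  conn_matrix (e g) (D b) c x s - conn_matrix (e g) (D a) c x s.

Definition atiyah k : cochain 'M[CC R]_r k := fun al =>
  \big[@eprod R n X r/@eone R n X r]_(i < k)
    omega (al ord0) (al (widen_ord (leqnSn k) i)) (al (lift ord0 i)).

(* Matrix of the barycentric connection \sum_i t_i nabla_{al i} in the frame
   e_{al 0}; it is \sum_(i >= 1) t_i omega_{al 0, al i} when that frame is flat
   for nabla_{al 0}. *)
Definition bary_matrix p (al : 'I_p.+1 -> A) : mform X r p := fun t w c x s =>
  if w is [::] then
    \sum_(i < p.+1) (barycentric t i)%:C%C *: conn_matrix (e (al ord0)) (D (al i)) c x s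
  else 0.

Definition bary_curv p (al : 'I_p.+1 -> A) : mform X r p := fun t w c x s =>
  mdiff (bary_matrix al) t w c x s +
  mprod (bary_matrix al) (bary_matrix al) t w c x s.

Definition simplicial_atiyah k p (al : 'I_p.+1 -> A) : mform X r p :=
  fun t w c x s => (-1) ^+ (k * k.-1)./2 *:
    (\big[@mprod R n X r p/@mone R n X r p]_(i < k) bary_curv al) t w c x s.

Definition trace_fibre_int k p : cochain (CC R) p := fun al =>
  etrace (fibre_int (@simplicial_atiyah k) al).

Definition trace_atiyah k : cochain (CC R) k := fun al => etrace (atiyah al).

End Cech.

Arguments bidegree {R n X A} p q b.
Arguments trace_fibre_int {R n X A U r E} e D k p.
Arguments trace_atiyah {R n X A U r E} e D k.

(* Main.v *)
Require Import Defs.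
From mathcomp Require Import all_boot all_order all_algebra all_fingroup.
From mathcomp Require Import complex.
From mathcomp Require Import all_classical all_reals all_analysis.
From mathcomp Require Import ring zify.

(** The curvature of the barycentric connection has only components of type
    (2, 0) and (1, 1), the second one being
    [- \sum_i omega_{0 i} (x) dt_i].  In a k-fold product, simplex degree k can
    only be reached by taking the (1, 1) part of every factor, so the part of
    type (k, k) of [kappa^k] is the alternating sum over tau in S_k of
    [omega_{0 tau(1)} ... omega_{0 tau(k)}], times [dt_1 ... dt_k] and a sign.
    It does not depend on t: integrating it multiplies it by the volume 1/k! of
    the simplex, and the sign cancels against epsilon_k and the sign of the
    fibre integral ([curv_pow_top], [fibre_int_top]).

    Under the trace all matrices may be written in the frame of one fixed index,
    because a change of frame conjugates the differences of two connections
    ([omega_change], [tr_prod_omega]).  There omega_{a b} is a difference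
    [th_b - th_a] of connection matrices.  After skew-symmetrisation over
    S_{k+1} the sum over tau is absorbed, and it remains to compare the
    alternating sums of the products of [th_{s i} - th_{s 0}], 0 < i <= k (the
    edges of a star), and of [th_{s i} - th_{s (i - 1)}] (the edges of a path).

    Both are instances of one computation, valid for noncommuting factors: the
    alternating sum of a product of k linear combinations, with integer
    coefficients C, of k + 1 quantities equals the determinant of C, completed
    by a first row of ones, times the alternating sum of the monomials
    ([alt_det]).  An edge of the path is a difference of two edges of the star,
    so that the two determinants agree by row operations ([det_path_star]).

    That the cochains consist of holomorphic forms is proved for the Atiyah
    cocycle, which is a product of holomorphic matrices of 1-forms
    ([holo_conn_matrix], [holo_eprod_big]), and transported along the equality,
    since the finite intersections are open.

    In all this, the product with a 1-form is evaluated by a cofactor expansion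
    ([shuffle_sum1]), which iterates to sums over permutations
    ([lap_sum_perm], [lap_sum_perm2]). *)

Set Implicit Arguments.
Unset Strict Implicit.
Unset Printing Implicit Defensive.

Import Order.TTheory GRing.Theory Num.Theory.
Import numFieldNormedType.Exports.

Local Open Scope classical_set_scope.
Local Open Scope ring_scope.

(** * Permutations of k + 1 points *)

(** A permutation of k + 1 points amounts to the image j of the first point
    and a permutation of the k others, as the cardinals agree.  This turns
    iterated cofactor expansions into sums over permutations. *)
Lemma sum_perm_recl (V : nmodType) k (F : 'S_k.+1 -> V) :
  \sum_(s : 'S_k.+1) F s =
  \sum_(j < k.+1) \sum_(s : 'S_k) F (lift_perm ord0 j s).
Proof.
rewrite pair_bigA (reindex (fun js : 'I_k.+1 * 'S_k => lift_perm ord0 js.1 js.2)) //=.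
apply/onW_bij/inj_card_bij; last by rewrite card_prod card_ord !card_Sn factS.
move=> [j s] [j' s'] /= /permP E.
have jj' : j = j' by have := E ord0; rewrite !lift_perm_id.
congr (_, _) => //; apply/permP => i.
by have := E (lift ord0 i); rewrite !lift_perm_lift jj' => /lift_inj.
Qed.

Lemma sum_perm0 (V : nmodType) (F : 'S_0 -> V) : \sum_(s : 'S_0) F s = F 1%g.
Proof.
rewrite (big_pred1 1%g) // => s.
by apply/esym/eqP/permP => -[].
Qed.

Lemma prod_perm_recl (K : pzRingType) k (f : 'I_k.+1 -> nat -> K)
    (j : 'I_k.+1) (s : 'S_k) :
  \prod_i f i (lift_perm ord0 j s i) =
  f ord0 j * \prod_i f (lift ord0 i) (lift j (s i)).
Proof.
rewrite big_ord_recl lift_perm_id; congr (_ * _).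
by apply: eq_bigr => i _; rewrite lift_perm_lift.
Qed.

(** * Cofactor expansions *)

(** A cofactor expansion along the entries of s, whose usual indexed form is
    [lap_sumE].  The recursion on the list makes it possible to cut the
    expansion at a given entry ([lap_sum_cat]). *)
Fixpoint lap_sum (T : Type) (V : zmodType) (F : T -> seq T -> V) (s : seq T) : V :=
  if s is x :: s' then F x s' - lap_sum (fun y t => F y (x :: t)) s' else 0.

Lemma eq_lap_sum (T : Type) (V : zmodType) (F G : T -> seq T -> V) s :
  (forall x t, (size t).+1 = size s -> F x t = G x t) -> lap_sum F s = lap_sum G s.
Proof.
elim: s F G => //= x s IH F G FG; rewrite FG //; congr (_ - _).
by apply: IH => y t st; apply: FG; rewrite /= st.
Qed.

Lemma lap_sum_map (T U : Type) (V : zmodType) (h : T -> U) (F : U -> seq U -> V) s :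
  lap_sum F (map h s) = lap_sum (fun x t => F (h x) (map h t)) s.
Proof. by elim: s F => //= x s IH F; rewrite IH. Qed.

Lemma lap_sum0 (T : Type) (V : zmodType) (s : seq T) :
  lap_sum (fun _ _ => 0 : V) s = 0.
Proof. by elim: s => //= x s ->; rewrite subr0. Qed.

Lemma lap_sumD (T : Type) (V : zmodType) (F G : T -> seq T -> V) s :
  lap_sum (fun x t => F x t + G x t) s = lap_sum F s + lap_sum G s.
Proof. by elim: s F G => [|x s IH] F G /=; rewrite ?addr0 // IH opprD addrACA. Qed.

Lemma lap_sum_sum (T : Type) (V : zmodType) (I : Type) (r : seq I) (P : pred I)
    (F : I -> T -> seq T -> V) s :
  lap_sum (fun x t => \sum_(i <- r | P i) F i x t) s =
  \sum_(i <- r | P i) lap_sum (F i) s.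
Proof.
elim: s F => [|x s IH] F /=; first by rewrite big1.
by rewrite IH sumrB.
Qed.

Lemma lap_sumZ (T : Type) (K : pzRingType) (V : lmodType K) (a : K)
    (F : T -> seq T -> V) s :
  lap_sum (fun x t => a *: F x t) s = a *: lap_sum F s.
Proof. by elim: s F => [|x s IH] F /=; rewrite ?scaler0 // IH scalerBr. Qed.

Lemma lap_sumM (T : Type) (K : pzRingType) (a : K) (F : T -> seq T -> K) s :
  lap_sum (fun u t => a * F u t) s = a * lap_sum F s.
Proof. by elim: s F => [|x s IH] F /=; rewrite ?mulr0 // mulrBr IH. Qed.

Lemma lap_sum_eq0 (T : Type) (V : zmodType) (F : T -> seq T -> V) s :
  (forall x t, (size t).+1 = size s -> F x t = 0) -> lap_sum F s = 0.
Proof. by move=> F0; rewrite -[RHS](lap_sum0 V s); apply: eq_lap_sum. Qed.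

Lemma lap_sum_mxE (T : Type) (K : zmodType) r (F : T -> seq T -> 'M[K]_r) s i j :
  lap_sum F s i j = lap_sum (fun u t => F u t i j) s.
Proof. by elim: s F => [|x s IH] F /=; rewrite !mxE // IH. Qed.

Lemma lap_sum_cat (T : Type) (V : zmodType) (F : T -> seq T -> V) s1 s2 :
  lap_sum F (s1 ++ s2) =
  lap_sum (fun x t => F x (t ++ s2)) s1 +
  lap_sum (fun x t => F x (s1 ++ t)) s2 *~ (-1) ^+ size s1.
Proof.
elim: s1 F => [|x s1 IH] F /=; first by rewrite add0r.
by rewrite IH exprS mulN1r mulrNz opprD addrA.
Qed.

Arguments omit : simpl never.

Lemma omit0 (T : Type) (x : T) s : omit 0 (x :: s) = s.
Proof. by rewrite /omit /= drop0. Qed.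

Lemma omitS (T : Type) (x : T) s i : omit i.+1 (x :: s) = x :: omit i s.
Proof. by []. Qed.

Lemma nth_omit (T : Type) (x0 : T) (s : seq T) i j :
  nth x0 (omit j s) i = nth x0 s (bump j i).
Proof.
elim: s i j => [|x s IH] i j; first by rewrite /omit !nth_nil.
case: j => [|j]; first by rewrite omit0.
by rewrite omitS; case: i => [|i] //=; rewrite IH bumpS.
Qed.

Lemma size_omit (T : Type) (s : seq T) j :
  (j < size s)%N -> size (omit j s) = (size s).-1.
Proof.
elim: s j => // x s IH [|j] js; first by rewrite omit0.
by rewrite omitS [LHS]/= IH //; case: s js {IH}.
Qed.

Lemma lap_sumE (T : Type) (x0 : T) (K : pzRingType) (V : lmodType K)
    (F : T -> seq T -> V) s :
  lap_sum F s = \sum_(i < size s) (-1) ^+ i *: F (nth x0 s i) (omit i s).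
Proof.
elim: s F => [|x s IH] F /=; first by rewrite big_ord0.
rewrite big_ord_recl /= omit0 scale1r IH; congr (_ + _).
by rewrite -sumrN; apply: eq_bigr => i _; rewrite exprS mulN1r scaleNr.
Qed.

(** * Sums over shuffles *)

Lemma sum_tuple_recl (V : nmodType) q (F : q.+1.-tuple bool -> V) :
  \sum_(m : q.+1.-tuple bool) F m =
  \sum_(m : q.-tuple bool) F [tuple of true :: m] +
  \sum_(m : q.-tuple bool) F [tuple of false :: m].
Proof.
rewrite (reindex (fun bm : bool * q.-tuple bool => [tuple of bm.1 :: bm.2])) /=.
  rewrite -(pair_big xpredT xpredT
    (fun (b : bool) (m : q.-tuple bool) => F [tuple of b :: m])) /=.
  by rewrite big_bool.
exists (fun m => (thead m, [tuple of behead m])) => [[b m] _ | m _] /=.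
  by congr (_, _); apply: val_inj.
by case/tupleP: m => b m; apply: val_inj.
Qed.

(** A selected head is preceded by nothing, and an unselected one is jumped
    over by all later selected positions. *)
Lemma shuffle_sign_cons (K : pzRingType) q b (m : q.-tuple bool) :
  shuffle_sign K [tuple of b :: m] =
  (-1) ^+ (~~ b * count id m) * shuffle_sign K m.
Proof.
have cardE q' (m' : q'.-tuple bool) :
    #|[set ij : 'I_q' * 'I_q' |
       [&& (ij.1 < ij.2)%N, ~~ tnth m' ij.1 & tnth m' ij.2]]| =
    (\sum_(i < q') \sum_(j < q') [&& (i < j)%N, ~~ tnth m' i & tnth m' j])%N.
  rewrite -sum1_card big_mkcond pair_bigA; apply: eq_bigr => -[i j] _ /=.
  rewrite -[_ \in _]/`[< [&& (i < j)%N, ~~ tnth m' i & tnth m' j] >] asboolb.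
  by case: ifP.
rewrite /shuffle_sign !cardE -exprD big_ord_recl; congr (_ ^+ (_ + _)%N).
  rewrite big_ord_recl /= add0n; case: b => /=.
    by rewrite mul0n big1.
  rewrite mul1n -sum1_count (big_tuple _ _ m) /=.
  by rewrite [RHS]big_mkcond; apply: eq_bigr => i _; rewrite tnthS; case: (tnth m i).
apply: eq_bigr => i _; rewrite big_ord_recl /= add0n.
by apply: eq_bigr => j _; rewrite !tnthS.
Qed.

Lemma size_masks (T : Type) (s : seq T) (m : (size s).-tuple bool) :
  (size (mask m s) + size (mask (map negb m) s))%N = size s.
Proof.
rewrite !size_mask ?size_map ?size_tuple // count_map.
by rewrite -[RHS](size_tuple m) -(count_predC id m).
Qed.

Lemma shuffle_sum0 (T : Type) (K : pzRingType) (V : lmodType K) (s : seq T)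
    (G : seq T -> seq T -> V) :
  (forall a b, (size a + size b)%N = size s -> size a != 0 -> G a b = 0) ->
  \sum_(m : (size s).-tuple bool)
    shuffle_sign K m *: G (mask m s) (mask (map negb m) s) = G [::] s.
Proof.
elim: s G => [|x s IH] G G0.
  rewrite (big_pred1 [tuple]) => [|m]; last by rewrite [m]tuple0 /= eqxx.
  rewrite /shuffle_sign; set n := #|_|.
  suff -> : n = 0%N by rewrite scale1r.
  by apply: eq_card0 => -[[]].
rewrite sum_tuple_recl big1 ?add0r => [|m _].
  rewrite -(IH (fun a b => G a (x :: b))); last first.
    by move=> a b ab a0; rewrite G0 //= addnS ab.
  apply: eq_bigr => m _ /=; rewrite shuffle_sign_cons mul1n.
  case: (eqVneq (size (mask m s)) 0%N) => [|a0].
    by rewrite size_mask ?size_tuple // => ->; rewrite mul1r.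
  by rewrite !G0 ?scaler0 //= addnS size_masks.
by rewrite /= G0 ?scaler0 //= addSn size_masks.
Qed.

(** A shuffle that selects the single position i has sign (-1)^i. *)
Lemma shuffle_sum1 (T : Type) (K : pzRingType) (V : lmodType K) (s : seq T)
    (G : seq T -> seq T -> V) :
  (forall a b, (size a + size b)%N = size s -> size a != 1 -> G a b = 0) ->
  \sum_(m : (size s).-tuple bool)
    shuffle_sign K m *: G (mask m s) (mask (map negb m) s) =
  lap_sum (fun x t => G [:: x] t) s.
Proof.
elim: s G => [|x s IH] G G1.
  by rewrite big1 // => m _; rewrite /= tuple0 G1 ?scaler0.
rewrite sum_tuple_recl [RHS]/=; congr (_ + _).
  rewrite -(@shuffle_sum0 T K V s (fun a b => G (x :: a) b)).
    by apply: eq_bigr => m _; rewrite shuffle_sign_cons mul0n mul1r.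
  by move=> a b ab a0; rewrite G1 //= addSn ab.
have /= <- := IH (fun a b => G a (x :: b)); last first.
  by move=> a b ab a0; rewrite G1 //= addnS ab.
rewrite -sumrN; apply: eq_bigr => m _ /=; rewrite shuffle_sign_cons mul1n.
case: (eqVneq (size (mask m s)) 1%N) => [|a0].
  by rewrite size_mask ?size_tuple // => ->; rewrite mulN1r scaleNr.
by rewrite !G1 ?scaler0 ?oppr0 //= addnS size_masks.
Qed.

(** * Iterated cofactor expansions *)

(** The step of an induction on the number of factors: position 0 is served by
    the entry j of s, the other factors by the entries of [omit j s]. *)
Lemma lap_sum_perm (T : Type) (x0 : T) (K : comNzRingType) r
    k (g : 'I_k.+1 -> T -> 'M[K]_r) (H : seq T -> 'M[K]_r) s :
  size s = k.+1 ->
  (forall t, size t = k -> H t = \sum_(p : 'S_k) (-1) ^+ p *: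
     \prod_i g (lift ord0 i) (nth x0 t (p i))) ->
  lap_sum (fun x t => g ord0 x * H t) s =
  \sum_(p : 'S_k.+1) (-1) ^+ p *: \prod_i g i (nth x0 s (p i)).
Proof.
move=> sk HE; rewrite (lap_sumE x0) sum_perm_recl sk.
apply: eq_bigr => j _; rewrite HE; last by rewrite size_omit sk.
rewrite mulr_sumr scaler_sumr; apply: eq_bigr => p _.
rewrite odd_lift_perm /= signr_addb signr_odd.
rewrite -[g _ _ * _]/(_ *m _) -scalemxAr scalerA; congr (_ *: _).
rewrite (prod_perm_recl (fun i l => g i (nth x0 s l))); congr (_ * _).
by apply: eq_bigr => i _; rewrite nth_omit.
Qed.

(** The analogue of [lap_sum_perm] for factors with one argument in each of
    two lists, alternated separately. *)
Lemma lap_sum_perm2 (S T : Type) (v0 : S) (u0 : T) (K : comNzRingType) r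
    k (g : S -> T -> 'M[K]_r) (H : seq S -> seq T -> 'M[K]_r) w s :
  size w = k.+1 -> size s = k.+1 ->
  (forall w' s', size w' = k -> size s' = k ->
     H w' s' = \sum_(q : 'S_k) \sum_(p : 'S_k) (-1) ^+ q *: ((-1) ^+ p *:
     \prod_i g (nth v0 w' (q i)) (nth u0 s' (p i)))) ->
  lap_sum (fun v w' => lap_sum (fun u s' => g v u * H w' s') s) w =
  \sum_(q : 'S_k.+1) \sum_(p : 'S_k.+1) (-1) ^+ q *: ((-1) ^+ p *:
     \prod_i g (nth v0 w (q i)) (nth u0 s (p i))).
Proof.
move=> wk sk HE; rewrite (lap_sumE v0) sum_perm_recl wk; apply: eq_bigr => j _.
under [RHS]eq_bigr do rewrite sum_perm_recl.
rewrite (lap_sumE u0) sk scaler_sumr [RHS]exchange_big; apply: eq_bigr => l _ /=.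
rewrite HE ?size_omit ?wk ?sk // mulr_sumr !scaler_sumr; apply: eq_bigr => q _.
rewrite mulr_sumr !scaler_sumr; apply: eq_bigr => p _.
rewrite -[g _ _ * _]/(_ *m _) -!scalemxAr !odd_lift_perm /= !signr_addb !signr_odd.
rewrite !scalerA; congr (_ *: _); first by rewrite mulrACA.
rewrite [RHS]big_ord_recl !lift_perm_id; congr (_ * _).
by apply: eq_bigr => i _; rewrite !nth_omit !lift_perm_lift.
Qed.

(** * Alternating sums of ordered products *)

Section Alt.
Variables (M : pzRingType) (k : nat) (f : 'I_k -> 'I_k.+1 -> M).

(** Not a determinant of elements of M: the factors stay in the order of the
    rows i, only the columns are permuted. *)
Definition alt (phi : 'I_k -> 'I_k.+1) : M :=
  \sum_(s : 'S_k.+1) (-1) ^+ s * \prod_i f i (s (phi i)).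

(** Exchanging the two unused values changes the sign of s and leaves all the
    factors as they are. *)
Lemma alt_missing2 phi a b : a != b ->
  (forall i, phi i != a) -> (forall i, phi i != b) -> alt phi = 0.
Proof.
move=> ab pa pb; rewrite /alt (bigID (@odd_perm _)) /=.
apply: canLR (subrK _) _; rewrite add0r -sumrN.
rewrite (reindex_inj (mulgI (tperm a b))); apply: eq_big => s /=.
  by rewrite odd_permM odd_tperm ab /=.
rewrite odd_permM odd_tperm ab /= => /negPf ->; rewrite mulN1r mul1r.
congr (- _); apply: eq_bigr => i _; rewrite permM tpermD // eq_sym //.
Qed.

(** If two of the k values coincide, at least two of the k + 1 indices are not
    used. *)
Lemma alt_non_injective phi : ~ injective phi -> alt phi = 0.
Proof.
move=> ninj.
have : (1 < #|[predC codom phi]|)%N.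
  rewrite -(ltn_add2l #|codom phi|) cardC card_ord addn1 ltnS.
  rewrite ltn_neqAle -[X in (_ <= X)%N]card_ord leq_image_card andbT.
  apply/negP => /eqP c; apply: ninj; apply: in2T; apply/image_injP.
  by rewrite card_ord c.
case/card_gt1P => a [b] [pa pb ab]; apply: (alt_missing2 ab) => i.
  by apply: contraNneq pa => <-; apply: codom_f.
by apply: contraNneq pb => <-; apply: codom_f.
Qed.

Lemma alt_perm (p : 'S_k.+1) :
  alt (p \o lift ord0) = (-1) ^+ p * alt (lift ord0).
Proof.
rewrite /alt big_distrr /= (reindex_inj (mulgI p^-1%g)); apply: eq_bigr => s _ /=.
rewrite odd_permM odd_permV signr_addb -mulrA; congr (_ * (_ * _)).
by apply: eq_bigr => i _; rewrite permM permK.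
Qed.

Lemma prodr_mulrz (I : Type) (r : seq I) (x : I -> M) (c : I -> int) :
  \prod_(i <- r) (x i *~ c i) = (\prod_(i <- r) x i) *~ (\prod_(i <- r) c i).
Proof.
elim: r => [|i r IH]; first by rewrite !big_nil.
by rewrite !big_cons IH mulrzAr mulrzAl mulrzA.
Qed.

(** For an injection phi, the only permutation of k + 1 points that extends
    it: the k values leave exactly one index for the new point. *)
Definition complete (phi : 'I_k -> 'I_k.+1) (i : 'I_k.+1) : 'I_k.+1 :=
  if unlift ord0 i is Some j then phi j else odflt ord0 [pick x in [predC codom phi]].

Lemma complete_inj phi : injective phi -> injective (complete phi).
Proof.
move=> inj; rewrite /complete; case: pickP => [x xP|no]; last first.
  have := cardC (mem (codom phi)); rewrite (eq_card0 no) addn0 card_ord.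
  by rewrite card_codom // card_ord => /eqP; rewrite ltn_eqF.
move=> i j; case: (unliftP ord0 i) => [i'|] ->; case: (unliftP ord0 j) => [j'|] -> //=.
- by move/inj ->.
- by move=> E; rewrite inE /= -E codom_f in xP.
- by move=> E; rewrite inE /= E codom_f in xP.
Qed.

(** Expanding the product gives a monomial for each choice phi of a column in
    every row.  Only injective choices survive; each of them is the
    restriction of a unique permutation p, and yields sgn p times the same
    monomial sum.  The coefficients thus add up to a determinant, in which the
    row of ones stands for the unweighted value of p at 0. *)
Lemma alt_det (C : 'M[int]_(k, k.+1)) :
  \sum_(s : 'S_k.+1) (-1) ^+ s * \prod_i \sum_j f i (s j) *~ C i j =
  alt (lift ord0) *~ \det (col_mx (const_mx 1 : 'rV_k.+1) C).
Proof.
under eq_bigr do rewrite (bigA_distr_bigA (fun i j => f i (_ j) *~ C i j)) /= mulr_sumr.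
rewrite exchange_big /=.
transitivity (\sum_(phi : {ffun 'I_k -> 'I_k.+1}) alt phi *~ \prod_i C i (phi i)).
  apply: eq_bigr => phi _; rewrite /alt mulrz_suml.
  by apply: eq_bigr => s _; rewrite prodr_mulrz mulrzAr.
rewrite (bigID (fun phi : {ffun 'I_k -> 'I_k.+1} => injectiveb phi)) /= addrC.
rewrite big1 ?add0r => [|phi /injectiveP ninj]; last by rewrite alt_non_injective ?mul0rz.
rewrite (reindex (fun p : 'S_k.+1 => [ffun i : 'I_k => p (lift ord0 i)])); last first.
  exists (fun phi : {ffun 'I_k -> 'I_k.+1} => if injectiveb phi =P true is ReflectT i
     then perm (complete_inj (injectiveP _ i)) else 1%g).
    move=> p _; case: eqP => [i|]; last first.
      by case; apply/injectiveP => i j; rewrite !ffunE => /perm_inj /lift_inj.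
    apply/permP => j; rewrite permE /complete; case: unliftP => [j' ->|->]; rewrite ?ffunE //.
    case: pickP => [x xP|no] /=.
      case: (unliftP ord0 (p^-1%g x)) => [y Ey|<-]; last by rewrite permKV.
      by move: xP; rewrite inE /= => /negP[]; apply/codomP; exists y; rewrite ffunE -Ey permKV.
    have := no (p ord0); rewrite inE /= => /negP/negP/codomP[y]; rewrite ffunE.
    by move/perm_inj => /eqP; rewrite (negPf (neq_lift _ _)).
  move=> phi inj; case: eqP => // i; apply/ffunP => j.
  by rewrite ffunE permE /complete liftK.
rewrite /determinant mulrz_sumr; apply: eq_big => [p|p _].
  by apply/injectiveP => i j; rewrite !ffunE => /perm_inj /lift_inj.
have -> : [ffun i : 'I_k => p (lift ord0 i)] = p \o lift ord0 :> ('I_k -> 'I_k.+1).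
  by apply/funext => i; rewrite ffunE.
rewrite alt_perm mulrzA.
have -> : alt (lift ord0) *~ (-1) ^+ p = (-1) ^+ p * alt (lift ord0).
  by case: (odd_perm p); rewrite ?mulN1r ?mul1r ?mulrN1z.
congr (_ *~ _).
rewrite (big_split_ord _ _ (fun i => col_mx (const_mx 1 : 'rV[int]_k.+1) C i (p i))).
rewrite big_ord1 /= col_mxEu mxE mul1r.
by apply: eq_bigr => i _; rewrite col_mxEd rshift1.
Qed.

(** The signed incidence matrix of the graph on {0, ..., k} whose edge number
    i joins [par i] to i + 1. *)
Definition tree_mx (par : 'I_k -> 'I_k.+1) : 'M[int]_(k, k.+1) :=
  \matrix_(i, j) ((j == lift ord0 i)%:Z - (j == par i)%:Z).

Lemma alt_tree par :
  \sum_(s : 'S_k.+1) (-1) ^+ s * \prod_i (f i (s (lift ord0 i)) - f i (s (par i))) =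
  alt (lift ord0) *~ \det (col_mx (const_mx 1 : 'rV_k.+1) (tree_mx par)).
Proof.
rewrite -alt_det; apply: eq_bigr => s _; congr (_ * _); apply: eq_bigr => i _.
have E l : \sum_j f i (s j) *~ (j == l)%:Z = f i (s l).
  rewrite (bigD1 l) //= eqxx mulr1z big1 ?addr0 // => j /negPf ->.
  by rewrite mulr0z.
rewrite -[in LHS](E (lift ord0 i)) -[X in _ - X](E (par i)) -sumrB.
by apply: eq_bigr => j _; rewrite mxE mulrzBr.
Qed.
End Alt.

(** The edge from i to i + 1 is the difference of the edges from 0 to i + 1
    and from 0 to i. *)
Lemma det_path_star k :
  \det (col_mx (const_mx 1 : 'rV_k.+1) (tree_mx (widen_ord (leqnSn k)))) =
  \det (col_mx (const_mx 1 : 'rV_k.+1) (tree_mx (fun=> ord0))).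
Proof.
(* L subtracts from each edge of the star but the first the preceding edge. *)
pose L : 'M[int]_k.+1 := \matrix_(i, j) ((j == i)%:Z - ((j != ord0) && (i == j.+1 :> nat))%:Z).
have dL : \det L = 1.
  rewrite det_trig.
    rewrite big1 // => i _; rewrite mxE eqxx.
    by rewrite (_ : (i == i.+1 :> nat) = false) ?andbF ?subr0 // ltn_eqF.
  apply/is_trig_mxP => i j ij; rewrite mxE.
  by rewrite -(val_eqE j i) /= (gtn_eqF ij) (ltn_eqF (leq_trans ij (leqnSn _))) andbF subr0.
have row0 (C : 'M[int]_(k, k.+1)) j : col_mx (const_mx 1 : 'rV_k.+1) C ord0 j = 1 :> int.
  transitivity (col_mx (const_mx 1 : 'rV_k.+1) C (lshift k (ord0 : 'I_1)) j).
    by congr (col_mx _ _ _ _); apply: val_inj.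
  by rewrite col_mxEu mxE.
have rowS (C : 'M[int]_(k, k.+1)) i j :
    col_mx (const_mx 1 : 'rV_k.+1) C (lift ord0 i) j = C i j :> int.
  by rewrite -rshift1 col_mxEd.
transitivity (\det L * \det (col_mx (const_mx 1 : 'rV_k.+1) (tree_mx (fun=> ord0)))); last first.
  by rewrite dL mul1r.
rewrite -det_mulmx; congr (\det _); apply/matrixP => i j.
rewrite [RHS]mxE.
under eq_bigr do rewrite mxE mulrBl.
rewrite sumrB (bigD1 i) //= eqxx mul1r big1 ?addr0 => [|l /negPf ->]; last by rewrite mul0r.
case: (unliftP ord0 i) => [i'|] ->; last first.
  by rewrite !row0 big1 ?subr0 // => l _; rewrite andbF mul0r.
rewrite !rowS !mxE; case: i' => -[|m] mk /=.
  rewrite big1 ?subr0 => [|l _]; first by congr (_ - (_ == _)%:Z); apply: val_inj.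
  rewrite (_ : _ && _ = false) ?mul0r //; apply/negP => /andP[l0 /eqP[] l0'].
  by case/negP: l0; apply/eqP/val_inj.
pose m' : 'I_k := Ordinal (ltnW mk).
rewrite (bigD1 (lift ord0 m')) //= rowS mxE /= /bump /= eqxx mul1r big1 ?addr0.
  rewrite opprB addrA subrK; congr (_ - (_ == _)%:Z); exact: val_inj.
move=> l lm; rewrite (_ : _ && _ = false) ?mul0r //; apply/negP => /andP[_ /eqP[] ml].
by case/negP: lm; apply/eqP/val_inj; rewrite /= /bump /= -ml.
Qed.

Lemma alt_path_star (M : pzRingType) k (f : 'I_k -> 'I_k.+1 -> M) :
  \sum_(s : 'S_k.+1) (-1) ^+ s *
    \prod_i (f i (s (lift ord0 i)) - f i (s (widen_ord (leqnSn k) i))) =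
  \sum_(s : 'S_k.+1) (-1) ^+ s *
    \prod_i (f i (s (lift ord0 i)) - f i (s ord0)).
Proof. by rewrite !alt_tree det_path_star. Qed.

(** * Integration and differentiation on the simplex *)

Lemma Rintegral_rev_pow (R : realType) (b : R) p (c : R) : 0 <= b ->
  \int[lebesgue_measure]_(x in `[0, b]) (c * (b - x) ^+ p) = c * b ^+ p.+1 / p.+1%:R.
Proof.
rewrite le_eqVlt => /predU1P[<-|b0].
  by rewrite set_itv1 Rintegral_set1 exprS mul0r mulr0 mul0r.
pose F (x : R) : R := - (c / p.+1%:R) * (b - x) ^+ p.+1.
have dF (x : R) : is_derive x 1 F (c * (b - x) ^+ p).
  have -> : F = - (c / p.+1%:R) \*: ((cst b - id) ^+ p.+1).
    by apply/funext => y; rewrite /F !fctE.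
  apply: is_derive_eq.
  rewrite sub0r scalerN scaler1 !fctE.
  have p0 : p.+1%:R != 0 :> R by [].
  rewrite -mulr_natl /GRing.scale /=; by field.
rewrite /Rintegral (@continuous_FTC2 R _ F 0 b) //=.
- rewrite /F subrr subr0 exprS mul0r mulr0 sub0r mulNr opprK.
  by rewrite mulrAC.
- apply: continuous_subspaceT => x.
  have : derivable (c \*: ((cst b - id) ^+ p)) (x : R) 1.
    by apply: derivableZ; apply: derivableX; apply: derivableB.
  by move=> /derivable1_diffP/differentiable_continuous; rewrite exprfctE.
- split.
  + by move=> x _; have [] := dF x.
  + apply: cvg_at_right_filter.
    by have [/derivable1_diffP/differentiable_continuous] := dF 0.
  + apply: cvg_at_left_filter.
    by have [/derivable1_diffP/differentiable_continuous] := dF b.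
- by move=> x _; rewrite derive1E; have [_ ->] := dF x.
Qed.

Lemma simplex_int_cst (R : realType) p (b c : R) : 0 <= b ->
  simplex_int b (fun _ : 'rV[R]_p => c) = c * b ^+ p / p`!%:R.
Proof.
elim: p b => [|p IH] b b0 /=; first by rewrite expr0 mulr1 divr1.
transitivity (\int[lebesgue_measure]_(x in `[0, b]) ((c / p`!%:R) * (b - x) ^+ p)).
  apply: eq_Rintegral => x; rewrite inE /= in_itv /= => /andP[_ xb].
  by rewrite IH ?subr_ge0 // mulrAC.
rewrite Rintegral_rev_pow // factS natrM invfM.
by rewrite -!mulrA; congr (c * _); rewrite mulrCA; congr (_ * _); rewrite mulrC.
Qed.

Lemma simplex_intC_cst (R : realType) p (c : CC R) :
  simplex_intC (fun _ : 'rV[R]_p => c) = c / p`!%:R.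
Proof.
rewrite /simplex_intC !simplex_int_cst // !expr1n !mulr1.
have -> : p`!%:R = (p`!%:R : R)%:C%C :> CC R by rewrite rmorph_nat.
rewrite -fmorphV; case: c => a b /=; apply/eqP; rewrite eq_complex /=.
by rewrite !mulr0 subr0 add0r !eqxx.
Qed.

Lemma derive_affine (R : realType) p (f : 'rV[R]_p -> R) (t v : 'rV[R]_p) (l : R) :
  (forall h : R, f (h *: v + t) - f t = h * l) -> 'D_v f t = l.
Proof.
move=> fl; rewrite /derive; apply: cvg_lim => //.
have : (fun=> l) @ (0 : R)^' --> l by exact: cvg_cst.
apply: cvg_trans; apply: near_eq_cvg; near=> h.
have h0 : h != 0 by near: h; exact: nbhs_dnbhs_neq.
by rewrite /= fl /GRing.scale /= mulKf.
Unshelve. all: by end_near. Qed.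

(** * Products of endomorphism-valued forms *)

Section Forms.
Variables (R : realType) (n : nat) (X : complex_manifold R n) (r : nat).
Implicit Types (c : chart_idx X) (x : X) (w : eform X r).

Lemma eprod_lap w w' c x s :
  (forall t, size t != 1 -> w c x t = 0) ->
  eprod w w' c x s = lap_sum (fun u t => w c x [:: u] *m w' c x t) s.
Proof.
move=> w1; rewrite /eprod.
rewrite (@shuffle_sum1 _ _ _ s (fun a b => w c x a *m w' c x b)) // => a b _ a1.
by rewrite w1 // mul0mx.
Qed.

Lemma eprod0l w w' c x s : (forall t, w c x t = 0) -> eprod w w' c x s = 0.
Proof.
by move=> w0; rewrite /eprod big1 // => m _; rewrite w0 mul0mx scaler0.
Qed.

Lemma eprod0r w w' c x s : (forall t, w' c x t = 0) -> eprod w w' c x s = 0.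
Proof.
by move=> w0; rewrite /eprod big1 // => m _; rewrite w0 mulmx0 scaler0.
Qed.

Lemma eprod_big_perm k (W : 'I_k -> eform X r) c x s :
  (forall i t, size t != 1 -> W i c x t = 0) -> size s = k ->
  (\big[@eprod R n X r/@eone R n X r]_(i < k) W i) c x s =
  \sum_(p : 'S_k) (-1) ^+ p *: \prod_(i < k) W i c x [:: nth 0 s (p i)].
Proof.
elim: k W s => [|k IH] W s W1 sk.
  by rewrite big_ord0 (size0nil sk) sum_perm0 big_ord0 odd_perm1 scale1r.
rewrite big_ord_recl eprod_lap; last exact: W1.
apply: (@lap_sum_perm _ 0 (CC R) r k (fun i u => W i c x [:: u])
  (fun t => (\big[@eprod R n X r/@eone R n X r]_(i < k) W (lift ord0 i)) c x t)) => //.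
by move=> t tk; apply: IH => // i u; apply: W1.
Qed.

Lemma eprod_big_size k (W : 'I_k -> eform X r) c x s :
  (forall i t, size t != 1 -> W i c x t = 0) -> size s != k ->
  (\big[@eprod R n X r/@eone R n X r]_(i < k) W i) c x s = 0.
Proof.
elim: k W s => [|k IH] W s W1 sk; first by rewrite big_ord0; case: s sk.
rewrite big_ord_recl eprod_lap; last exact: W1.
rewrite -(lap_sum0 _ s); apply: eq_lap_sum => u t ts; rewrite IH ?mulmx0 //.
  by move=> i v; apply: W1.
by apply: contraNneq sk => <-; rewrite ts.
Qed.

Lemma ediff0 w c x s : (forall y t, w c y t = 0) -> ediff w c x s = 0.
Proof.
move=> w0; apply/matrixP => a b; rewrite !mxE big1 // => i _.
rewrite /chart_deriv (_ : local_expr _ _ = cst 0) ?derive_cst ?mulr0 //.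
by apply/funext => y; rewrite /local_expr /= w0 mxE.
Qed.

Lemma mprodE p (M N : mform X r p) t (w : seq 'rV[R]_p) c x s :
  mprod M N t w c x s = \sum_(m : (size w).-tuple bool) shuffle_sign (CC R) m *:
    eprod (M t (mask m w)) (esign (size (mask m w)) (N t (mask (map negb m) w))) c x s.
Proof.
by apply: eq_bigr => m _; rewrite size_mask // size_tuple.
Qed.

Lemma real_deriv0 p (t v : 'rV[R]_p) : real_deriv (fun=> 0) t v = 0.
Proof. by rewrite /real_deriv /= !derive_cst. Qed.

Lemma esign0 p w c x s : (forall t, w c x t = 0) -> esign p w c x s = 0.
Proof. by move=> w0; rewrite /esign w0 scaler0. Qed.

End Forms.

(** * Powers of the barycentric curvature *)

Section Curvature.
Variables (R : realType) (n : nat) (X : complex_manifold R n).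
Variables (A : Type) (U : A -> set X) (r : nat).
Variables (E : holo_bundle X r) (e : A -> frame E).
Variable D : forall a, holo_connection E (U a).
Variables (p : nat) (al : 'I_p.+1 -> A).
Implicit Types (c : chart_idx X) (x : X) (t v : 'rV[R]_p) (w : seq 'rV[R]_p).

Lemma conn_matrix_size g a c x s : size s != 1 -> conn_matrix (e g) (D a) c x s = 0.
Proof. by case: s => [|u [|? ?]]. Qed.

Lemma omega_size g a b c x s : size s != 1 -> omega e D g a b c x s = 0.
Proof. by move=> s1; rewrite /omega !conn_matrix_size // subrr. Qed.

Lemma bary_matrix0 t w c x s : w != [::] -> bary_matrix e D al t w c x s = 0.
Proof. by case: w. Qed.

Lemma bary_sq0 t w c x s : w != [::] ->
  mprod (bary_matrix e D al) (bary_matrix e D al) t w c x s = 0.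
Proof.
move=> w0; rewrite mprodE big1 // => m _.
have [m0|m0] := eqVneq (mask m w) [::]; last first.
  by rewrite eprod0l ?scaler0 // => s'; rewrite bary_matrix0.
rewrite eprod0r ?scaler0 // => s'; rewrite esign0 // => s''; rewrite bary_matrix0 //.
by apply: contraNneq w0 => m0'; rewrite -size_eq0 -(size_masks m) m0 m0'.
Qed.

(** The connection matrix has simplex degree 0, and a single derivative in the
    direction of the simplex is taken. *)
Lemma bary_curv_ge2 t w c x s : (1 < size w)%N -> bary_curv e D al t w c x s = 0.
Proof.
move=> w1; rewrite /bary_curv bary_sq0; last by case: w w1.
rewrite addr0 /mdiff ediff0 ?add0r; last first.
  by move=> y s'; rewrite bary_matrix0 //; case: w w1.
rewrite esign0 // => s'; apply/matrixP => a b; rewrite !mxE big1 // => j _.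
rewrite (_ : (fun u => _) = fun=> 0) ?real_deriv0 ?mulr0 //.
apply/funext => u; rewrite bary_matrix0 ?mxE // -size_eq0 size_omit //.
by case: (size w) w1 => [|[]].
Qed.

Definition barycentric_deriv v (i : 'I_p.+1) : R :=
  if unlift ord0 i is Some j then v 0 j else - \sum_(j < p) v 0 j.

Definition bary_diff g v : eform X r := fun c x s =>
  \sum_(i < p.+1) (barycentric_deriv v i)%:C%C *: conn_matrix (e g) (D (al i)) c x s.

Lemma barycentricB t v (h : R) i :
  barycentric (h *: v + t) i - barycentric t i = h * barycentric_deriv v i.
Proof.
rewrite /barycentric /barycentric_deriv; case: unliftP => [j|] _; first by rewrite !mxE addrK.
rewrite opprB addrC addrA subrK mulrN mulr_sumr.
have -> : \sum_j (h *: v + t) 0 j = \sum_j (h * v 0 j + t 0 j).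
  by apply: eq_bigr => j _; rewrite !mxE.
by rewrite big_split /= opprD addrCA subrr addr0.
Qed.

Lemma real_deriv_bary t v (a : 'I_p.+1 -> CC R) :
  real_deriv (fun u => \sum_i (barycentric u i)%:C%C * a i) t v =
  \sum_i (barycentric_deriv v i)%:C%C * a i.
Proof.
(* The real and imaginary parts are differentiated separately. *)
have reim (b : 'I_p.+1 -> R) : \sum_i (b i)%:C%C * a i =
    Complex (\sum_i b i * complex.Re (a i)) (\sum_i b i * complex.Im (a i)) :> CC R.
  apply/eqP; rewrite eq_complex /= !raddf_sum /=.
  apply/andP; split; apply/eqP; apply: eq_bigr => i _; case: (a i) => y z /=.
    by rewrite mul0r subr0.
  by rewrite mul0r addr0.
rewrite reim /real_deriv; congr Complex; apply: derive_affine => h; rewrite !reim /=;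
  rewrite -sumrB mulr_sumr; apply: eq_bigr => i _;
  by rewrite -mulrBl barycentricB mulrA.
Qed.

(** Only the derivative of the connection matrix along the simplex
    contributes; the sign is (-1)^|xi| for the degree |xi| = 1 along X. *)
Lemma bary_curv1 t v c x s :
  bary_curv e D al t [:: v] c x s = - bary_diff (al ord0) v c x s.
Proof.
rewrite /bary_curv bary_sq0 // addr0 /mdiff ediff0 ?add0r; last first.
  by move=> y s'; rewrite bary_matrix0.
have [s1|s1] := eqVneq (size s) 1%N; last first.
  rewrite /bary_diff big1 ?oppr0 => [|i _]; last by rewrite conn_matrix_size ?scaler0.
  rewrite /esign (_ : mdiff_simplex _ _ _ _ _ _ = 0) ?scaler0 //.
  apply/matrixP => a b; rewrite !mxE big1 // => j _.
  rewrite (_ : (fun u => _) = fun=> 0) ?real_deriv0 ?mulr0 //.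
  apply/funext => u; rewrite /bary_matrix; case: (omit j _) => [|? ?]; last by rewrite mxE.
  by rewrite big1 ?mxE // => i _; rewrite conn_matrix_size ?scaler0.
rewrite /esign s1 scaleN1r; congr (- _); apply/matrixP => a b.
rewrite !mxE big_ord1 expr0 mul1r summxE /=.
rewrite [RHS](_ : _ = \sum_i (barycentric_deriv v i)%:C%C *
    conn_matrix (e (al ord0)) (D (al i)) c x s a b); last first.
  by apply: eq_bigr => i _; rewrite mxE.
rewrite -(real_deriv_bary t); congr (real_deriv _ t v); apply/funext => u.
by rewrite /omit /= /bary_matrix summxE; apply: eq_bigr => i _; rewrite mxE.
Qed.

Lemma bary_diff_delta g (j : 'I_p) c x s :
  bary_diff g (delta_mx 0 j) c x s = omega e D g (al ord0) (al (lift ord0 j)) c x s.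
Proof.
rewrite /bary_diff /omega big_ord_recl (bigD1 j) //= big1 => [|i ij].
  rewrite /barycentric_deriv unlift_none liftK !mxE !eqxx /= (bigD1 j) //= big1 => [|l /negPf lj].
    by rewrite mxE !eqxx /= addr0 rmorphN !rmorph1 scaleN1r scale1r addr0 addrC.
  by rewrite mxE lj andbF.
by rewrite /barycentric_deriv liftK mxE (negPf ij) andbF scale0r.
Qed.

Definition curv_pow k : mform X r p :=
  \big[@mprod R n X r p/@mone R n X r p]_(i < k) bary_curv e D al.

Lemma curv_pow0 k t w c x s : (k < size w)%N -> curv_pow k t w c x s = 0.
Proof.
elim: k w s => [|k IH] w s kw; first by rewrite /curv_pow big_ord0; case: w kw.
rewrite /curv_pow big_ord_recl -/(curv_pow k) mprodE big1 // => m _.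
have [kb|kb] := ltnP k (size (mask (map negb m) w)).
  by rewrite eprod0r ?scaler0 // => s'; rewrite esign0 // => s''; rewrite IH.
rewrite eprod0l ?scaler0 // => s'; rewrite bary_curv_ge2 //.
by rewrite ltnNge; apply/negP => le1; move: (leq_add le1 kb); rewrite size_masks leqNgt kw.
Qed.

(** Each factor must contribute its part of simplex degree 1, which has degree
    1 along X.  A factor followed by j others contributes a sign -1 by
    [bary_curv1] and a Koszul sign (-1)^j for passing a 1-form of the simplex
    over a j-form of X; in total k (k + 1) / 2 signs. *)
Lemma curv_pow_top k t w c x s : size w = k -> size s = k ->
  curv_pow k t w c x s = (-1) ^+ (k * k.+1)./2 *:
   \sum_(q : 'S_k) \sum_(l : 'S_k) (-1) ^+ q *: ((-1) ^+ l *: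
     \prod_(i < k) bary_diff (al ord0) (nth 0 w (q i)) c x [:: nth 0 s (l i)]).
Proof.
elim: k w s => [|k IH] w s wk sk.
  rewrite (size0nil wk) (size0nil sk) /curv_pow big_ord0 scale1r /=.
  by rewrite !sum_perm0 big_ord0 odd_perm1 !scale1r.
rewrite /curv_pow big_ord_recl -/(curv_pow k) mprodE.
rewrite (@shuffle_sum1 _ _ _ w (fun a b =>
  eprod (bary_curv e D al t a) (esign (size a) (curv_pow k t b)) c x s)); last first.
  case=> [|a [|a' w1]] b //=; rewrite wk => bk _.
    by rewrite eprod0r // => s'; rewrite esign0 // => s''; rewrite curv_pow0 -?bk.
  by rewrite eprod0l // => s'; rewrite bary_curv_ge2.
pose H (w' : seq 'rV[R]_p) (s' : seq 'rV[CC R]_n) : 'M[CC R]_r :=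
  \sum_(q : 'S_k) \sum_(l : 'S_k) (-1) ^+ q *: ((-1) ^+ l *:
     \prod_(i < k) bary_diff (al ord0) (nth 0 w' (q i)) c x [:: nth 0 s' (l i)]).
rewrite -(lap_sum_perm2 (g := fun v u => bary_diff (al ord0) v c x [:: u]) (H := H)) //.
rewrite -lap_sumZ; apply: eq_lap_sum => v w' ww'.
rewrite eprod_lap => [|s' s1]; last first.
  rewrite bary_curv1 /bary_diff big1 ?oppr0 // => i _.
  by rewrite conn_matrix_size ?scaler0.
rewrite -lap_sumZ; apply: eq_lap_sum => u s' ss'.
have w'k : size w' = k by move: ww'; rewrite wk => -[].
have s'k : size s' = k by move: ss'; rewrite sk => -[].
rewrite bary_curv1 /esign IH // -/(H w' s') s'k mul1n mulNmx -scaleN1r.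
rewrite -!scalemxAr !scalerA -exprD -exprS.
rewrite -[_ *m _]/(bary_diff _ v c x [:: u] * H w' s').
suff -> : ((k + (k * k.+1)./2).+1 = (k.+1 * k.+2)./2)%N by [].
have -> : (k.+1 * k.+2 = k * k.+1 + (k.+1).*2)%N by lia.
by rewrite halfD odd_double andbF add0n doubleK addnS addnC.
Qed.

(** The sign of the fibre integral in bidegree (k, k), times epsilon_k, times
    the sign of [curv_pow_top]. *)
Lemma sign_collect k :
  (-1) ^+ (k * k) * ((-1) ^+ (k * k.-1)./2 * (-1) ^+ (k * k.+1)./2) = 1 :> CC R.
Proof.
rewrite -!exprD (_ : (_ + _ = (k * k).*2)%N) ?(mul2n, sqrr_sign) //.
  by rewrite -mul2n exprM sqrrN expr1n expr1n.
case: k => [|k] //=.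
have o : odd (k.+1 * k.+2) = false by rewrite oddM /= negbK andNb.
have o' : odd (k.+1 * k) = false by rewrite oddM /= andNb.
have := odd_double_half (k.+1 * k.+2); have := odd_double_half (k.+1 * k).
by rewrite o o' !add0n; nia.
Qed.

End Curvature.

Section FibreIntegral.
Variables (R : realType) (n : nat) (X : complex_manifold R n).
Variables (A : Type) (U : A -> set X) (r : nat).
Variables (E : holo_bundle X r) (e : A -> frame E).
Variable D : forall a, holo_connection E (U a).

(** The integrand is constant on the simplex, whose volume is 1/k!. *)
Lemma fibre_int_top k (al : 'I_k.+1 -> A) (c : chart_idx X) x s : size s = k ->
  fibre_int (@simplicial_atiyah R n X A U r E e D k) al c x s =
  k`!%:R^-1 *: \sum_(q : 'S_k) \sum_(l : 'S_k) (-1) ^+ q *: ((-1) ^+ l *: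
     \prod_(i < k) omega e D (al ord0) (al ord0) (al (lift ord0 (q i))) c x
        [:: nth 0 s (l i)]).
Proof.
move=> sk; rewrite /fibre_int /esign sk.
set W := \sum_q _.
rewrite (_ : \matrix_(a, b) _ = k`!%:R^-1 *: ((-1) ^+ (k * k.-1)./2 *:
  ((-1) ^+ (k * k.+1)./2 *: W))).
  by rewrite !scalerA mulrAC sign_collect mul1r.
apply/matrixP => a b; rewrite [LHS]mxE [RHS]mxE.
rewrite mulrC -simplex_intC_cst; congr simplex_intC; apply/funext => t.
rewrite /simplicial_atiyah -/(curv_pow e D al k).
have sw : size [seq delta_mx 0 j : 'rV[R]_k | j <- enum 'I_k] = k.
  by rewrite size_map size_enum_ord.
rewrite (curv_pow_top _ _ _ _ _ _ sw sk).
set W' := \sum_q _; have -> : W' = W; last by [].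
apply: eq_bigr => q _; apply: eq_bigr => l _.
congr (_ *: (_ *: _)); apply: eq_bigr => i _.
by rewrite (nth_map (q i)) ?size_enum_ord // nth_ord_enum bary_diff_delta.
Qed.

Lemma atiyah_top k (al : 'I_k.+1 -> A) (c : chart_idx X) x s : size s = k ->
  atiyah e D al c x s = \sum_(l : 'S_k) (-1) ^+ l *: \prod_(i < k)
    omega e D (al ord0) (al (widen_ord (leqnSn k) i)) (al (lift ord0 i)) c x
      [:: nth 0 s (l i)].
Proof. by move=> sk; apply: eprod_big_perm => // i t; apply: omega_size. Qed.

Lemma atiyah_size k (al : 'I_k.+1 -> A) (c : chart_idx X) x s : size s != k ->
  atiyah e D al c x s = 0.
Proof. by move=> sk; apply: eprod_big_size => // i t; apply: omega_size. Qed.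

End FibreIntegral.

(** * Holomorphic functions and forms *)

Lemma near_eq_differentiable (K : numFieldType) (V W : normedModType K)
    (f g : V -> W) (a : V) :
  (\forall y \near a, f y = g y) -> differentiable f a -> differentiable g a.
Proof.
move=> fg df; have fga : f a = g a by exact: nbhs_singleton fg.
have dc : continuous ('d f a) by exact: diff_continuous.
have key : g \o shift a = cst (g a) + 'd f a +o_ (0 : V) id.
  apply/eqaddoP => _/posnumP[eps].
  have eps0 : 0 < eps%:num by [].
  have /eqaddoP h := diff_locally df; have {h} := h _ eps0.
  have : \forall y \near (0 : V), f (y + a) = g (y + a).
    by move: fg; rewrite (near_shift 0) /= subr0.
  move=> near1 near2; near=> y.
  have fy : f (y + a) = g (y + a) by near: y.
  rewrite !fctE /= /shift /= -fy -fga.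
  exact: (near near2 y).
by apply/diff_locallyP; rewrite (diff_unique dc key).
Unshelve. all: by end_near. Qed.

Section HoloForms.
Variables (R : realType) (n : nat) (X : complex_manifold R n).
Implicit Types (V W : set X) (c : chart_idx X) (f : X -> CC R).

Lemma near_chart V c x : open V -> V x -> in_chart c x ->
  \forall y \near coords c x,
    V (cinv (charts c) y) /\ in_chart c (cinv (charts c) y).
Proof.
move=> oV Vx cx; have xK : cinv (charts c) (coords c x) = x by exact: cmapK.
have cc : {for coords c x, continuous (cinv (charts c))}.
  by apply: cinv_continuous; exists x.
have oI : open (V `&` cdom (charts c)) by apply: openI => //; apply: cdom_open.
have N : nbhs (cinv (charts c) (coords c x)) (V `&` cdom (charts c)).
  by rewrite xK; apply: open_nbhs_nbhs; split.
exact: (cc _ N).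
Qed.

Lemma eq_local_differentiable V c x f g : open V -> V x -> in_chart c x ->
  (forall y, V y -> in_chart c y -> f y = g y) ->
  differentiable (local_expr c f) (coords c x) ->
  differentiable (local_expr c g) (coords c x).
Proof.
move=> oV Vx cx fg; apply: near_eq_differentiable.
apply: filterS (near_chart oV Vx cx) => y [Vy cy]; exact: fg.
Qed.

Lemma eq_holo_fun V f g : open V -> (forall y, V y -> f y = g y) ->
  holo_fun V f -> holo_fun V g.
Proof.
move=> oV fg hf c x Vx cx.
by apply: (eq_local_differentiable oV Vx cx _ (hf c x Vx cx)) => y Vy _; apply: fg.
Qed.

Lemma holo_fun_ext V f g : (forall y, f y = g y) -> holo_fun V f -> holo_fun V g.
Proof. by move=> /funext ->. Qed.

Lemma holo_fun_sub V W f : V `<=` W -> holo_fun W f -> holo_fun V f.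
Proof. by move=> VW hf c x /VW; apply: hf. Qed.

Lemma holo_fun_cst V a : holo_fun V (fun=> a).
Proof. by move=> c x _ _; apply: differentiable_cst. Qed.

Lemma holo_funD V f g : holo_fun V f -> holo_fun V g -> holo_fun V (fun y => f y + g y).
Proof. by move=> hf hg c x Vx cx; apply: differentiableD; [apply: hf|apply: hg]. Qed.

Lemma holo_funM V f g : holo_fun V f -> holo_fun V g -> holo_fun V (fun y => f y * g y).
Proof. by move=> hf hg c x Vx cx; apply: differentiableM; [apply: hf|apply: hg]. Qed.

Lemma holo_funV V f : holo_fun V f -> (forall y, V y -> f y != 0) ->
  holo_fun V (fun y => (f y)^-1).
Proof.
move=> hf f0 c x Vx cx; apply: (@differentiableV _ _ (local_expr c f)); first exact: hf.
by rewrite /local_expr /= [cinv _ _]cmapK // f0.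
Qed.

Lemma holo_fun_sum V (I : Type) (r : seq I) (P : pred I) (F : I -> X -> CC R) :
  (forall i, P i -> holo_fun V (F i)) -> holo_fun V (fun y => \sum_(i <- r | P i) F i y).
Proof.
move=> hF; elim: r => [|i r IH].
  by apply: (holo_fun_ext _ (@holo_fun_cst V 0)) => y; rewrite big_nil.
case Pi: (P i); last by apply: (holo_fun_ext _ IH) => y; rewrite big_cons Pi.
by apply: (holo_fun_ext _ (holo_funD (hF _ Pi) IH)) => y; rewrite big_cons Pi.
Qed.

Lemma holo_fun_prod V (I : Type) (r : seq I) (P : pred I) (F : I -> X -> CC R) :
  (forall i, P i -> holo_fun V (F i)) -> holo_fun V (fun y => \prod_(i <- r | P i) F i y).
Proof.
move=> hF; elim: r => [|i r IH].
  by apply: (holo_fun_ext _ (@holo_fun_cst V 1)) => y; rewrite big_nil.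
case Pi: (P i); last by apply: (holo_fun_ext _ IH) => y; rewrite big_cons Pi.
by apply: (holo_fun_ext _ (holo_funM (hF _ Pi) IH)) => y; rewrite big_cons Pi.
Qed.

Lemma holo_fun_det V m (M : X -> 'M[CC R]_m) :
  (forall i j, holo_fun V (fun y => M y i j)) -> holo_fun V (fun y => \det (M y)).
Proof.
move=> hM; apply: holo_fun_sum => s _; apply: holo_funM; first exact: holo_fun_cst.
by apply: holo_fun_prod => i _; apply: hM.
Qed.

Lemma holo_fun_invmx V m (M : X -> 'M[CC R]_m) : open V ->
  (forall i j, holo_fun V (fun y => M y i j)) -> (forall y, V y -> M y \in unitmx) ->
  forall i j, holo_fun V (fun y => invmx (M y) i j).
Proof.
move=> oV hM uM i j.
have adjE y : V y -> (\det (M y))^-1 * cofactor (M y) j i = invmx (M y) i j.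
  by move=> Vy; rewrite /invmx uM // mxE mxE.
apply: (eq_holo_fun oV adjE).
apply: holo_funM.
  apply: holo_funV; first exact: holo_fun_det.
  by move=> y /uM; rewrite unitmxE unitfE.
apply: holo_funM; first exact: holo_fun_cst.
apply: holo_fun_det => k l.
apply: (holo_fun_ext _ (hM (lift j k) (lift i l))) => y; by rewrite !mxE.
Qed.

Implicit Types (w : Defs.form X (CC R)) (q : nat).

Lemma eq_holo_form V q w w' : open V ->
  (forall c x s, V x -> in_chart c x -> w c x s = w' c x s) ->
  holo_form V q w -> holo_form V q w'.
Proof.
move=> oV ww' hw c x Vx cx; have [h1 h2 h3 h4 h5] := hw c x Vx cx.
split.
- by move=> s; rewrite -ww' //; apply: h1.
- by move=> *; rewrite -!ww' //; apply: h2.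
- by move=> *; rewrite -!ww' //; apply: h3.
- move=> s; apply: (eq_local_differentiable oV Vx cx _ (h4 s)) => y Vy cy; exact: ww'.
- by move=> c' s cx'; rewrite -!ww' //; apply: h5.
Qed.

Lemma holo_form0 V q : holo_form V q (fun _ _ _ => 0).
Proof.
move=> c x _ _; split=> [s _|s1 s2 a u v|s1 s2 s3 u|s|c' s _].
- by [].
- by rewrite mulr0 addr0.
- by [].
- exact: differentiable_cst.
- by [].
Qed.

Lemma holo_formD V q w w' : holo_form V q w -> holo_form V q w' ->
  holo_form V q (fun c x s => w c x s + w' c x s).
Proof.
move=> hw hw' c x Vx cx; have [h1 h2 h3 h4 h5] := hw c x Vx cx.
have [g1 g2 g3 g4 g5] := hw' c x Vx cx.
split=> *.
- by rewrite h1 ?g1 ?addr0.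
- by rewrite h2 g2 mulrDr addrACA.
- by rewrite h3 g3 addr0.
- by apply: differentiableD; [apply: h4|apply: g4].
- by rewrite h5 ?g5.
Qed.

Lemma holo_formZ V q f w : holo_fun V f -> holo_form V q w ->
  holo_form V q (fun c x s => f x * w c x s).
Proof.
move=> hf hw c x Vx cx; have [h1 h2 h3 h4 h5] := hw c x Vx cx.
split=> *.
- by rewrite h1 ?mulr0.
- by rewrite h2 mulrDr mulrCA.
- by rewrite h3 mulr0.
- by apply: differentiableM; [apply: hf|apply: h4].
- by rewrite h5.
Qed.

Lemma holo_form_sum V q (I : Type) (r : seq I) (F : I -> Defs.form X (CC R)) :
  (forall i, holo_form V q (F i)) ->
  holo_form V q (fun c x s => \sum_(i <- r) F i c x s).
Proof.
move=> hF; elim: r => [|i r IH].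
  rewrite (_ : (fun c x s => _) = fun _ _ _ => 0); first exact: holo_form0.
  by apply/funext=> c; apply/funext=> x; apply/funext => s; rewrite big_nil.
rewrite (_ : (fun c x s => _) =
  fun c x s => F i c x s + \sum_(i <- r) F i c x s); first exact: holo_formD.
by apply/funext=> c; apply/funext=> x; apply/funext => s; rewrite big_cons.
Qed.

(** Polarising at u + v shows that transposing two neighbours changes the
    sign; u is moved over s2 one entry at a time. *)
Lemma alternating_skew (w : seq 'rV[CC R]_n -> CC R) :
  (forall s1 s2 a u v, w (s1 ++ (a *: u + v) :: s2) =
     a * w (s1 ++ u :: s2) + w (s1 ++ v :: s2)) ->
  (forall s1 s2 s3 u, w (s1 ++ u :: s2 ++ u :: s3) = 0) ->
  forall s1 s2 s3 u, w (s1 ++ u :: s2 ++ s3) = w (s1 ++ s2 ++ u :: s3) *~ (-1) ^+ size s2.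
Proof.
move=> wD wA s1 s2 s3 u; elim: s2 s1 => [|v s2 IH] s1 /=; first by rewrite mulr1z.
have := IH (rcons s1 v); rewrite !cat_rcons => IHv.
rewrite exprS mulN1r mulrNz -IHv; apply/eqP; rewrite -addr_eq0; apply/eqP.
(* The coefficient 1 gives u + v the form required by the linearity of w. *)
have := wA s1 [::] (s2 ++ s3) (1 *: u + v); rewrite /= wD mul1r.
have wD' t y : w (s1 ++ t :: (1 *: u + v) :: y) = w (s1 ++ t :: u :: y) + w (s1 ++ t :: v :: y).
  by have := wD (rcons s1 t) y 1 u v; rewrite !cat_rcons mul1r.
rewrite !wD'; have /= := wA s1 [::] (s2 ++ s3); move=> ->; rewrite add0r.
by have /= := wA s1 [::] (s2 ++ s3); move=> ->; rewrite addr0.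
Qed.

(** For the alternation, the terms of the cofactor expansion that keep both
    copies of u vanish.  The two others differ by the move of u over s2 and by
    the position of u in the expansion, hence by the signs (-1)^|s2| and
    (-1)^(|s2| + 1). *)
Lemma holo_form_wedge1 V q w w' : holo_form V 1 w -> holo_form V q w' ->
  holo_form V q.+1 (fun c x s => lap_sum (fun u t => w c x [:: u] * w' c x t) s).
Proof.
move=> hw hw' c x Vx cx; have [h1 h2 h3 h4 h5] := hw c x Vx cx.
have [g1 g2 g3 g4 g5] := hw' c x Vx cx.
have w1D a u v : w c x [:: a *: u + v] = a * w c x [:: u] + w c x [:: v].
  exact: (h2 [::] [::]).
split.
- move=> s sq; apply: lap_sum_eq0 => u t ts; rewrite g1 ?mulr0 //.
  by apply: contraNneq sq => <-; rewrite ts.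
- move=> s1 s2 a u v; rewrite !lap_sum_cat /=.
  have -> : lap_sum (fun y t => w c x [:: y] * w' c x (t ++ (a *: u + v) :: s2)) s1 =
      a * lap_sum (fun y t => w c x [:: y] * w' c x (t ++ u :: s2)) s1 +
      lap_sum (fun y t => w c x [:: y] * w' c x (t ++ v :: s2)) s1.
    rewrite -lap_sumM -lap_sumD; apply: eq_lap_sum => y t _.
    by rewrite g2 mulrDr mulrCA.
  have -> : lap_sum (fun y t => w c x [:: y] * w' c x (s1 ++ (a *: u + v) :: t)) s2 =
      a * lap_sum (fun y t => w c x [:: y] * w' c x (s1 ++ u :: t)) s2 +
      lap_sum (fun y t => w c x [:: y] * w' c x (s1 ++ v :: t)) s2.
    rewrite -lap_sumM -lap_sumD; apply: eq_lap_sum => y t _.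
    by rewrite g2 mulrDr mulrCA.
  rewrite w1D mulrDl -mulrA opprD addrACA -mulrBr [in LHS]mulrzDl -[in LHS]mulrzAr.
  by rewrite mulrDr addrACA.
- move=> s1 s2 s3 u; rewrite lap_sum_cat /= lap_sum_cat /=.
  rewrite lap_sum_eq0 ?add0r; last by move=> y t _; rewrite g3 mulr0.
  rewrite [X in _ - (X + _)]lap_sum_eq0 ?add0r; last first.
    by move=> y t _; rewrite (g3 s1 t s3 u) mulr0.
  rewrite lap_sum_eq0 ?subr0; last first.
    by move=> y t _; rewrite (g3 s1 s2 t u) mulr0.
  rewrite (alternating_skew g2 g3 s1 s2 s3 u) mulrzAr -mulrzA -expr2 sqrr_sign mulr1z.
  by rewrite subrr mul0rz.
- move=> s.
  have key (F : X -> 'rV[CC R]_n -> seq 'rV[CC R]_n -> CC R) :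
      (forall u t, differentiable (local_expr c (fun y => F y u t)) (coords c x)) ->
      differentiable (local_expr c (fun y => lap_sum (F y) s)) (coords c x).
    elim: s F => [|v s IH] F dF; first exact: differentiable_cst.
    apply: differentiableB; first exact: dF.
    by apply: (IH (fun y u t => F y u (v :: t))) => u t; apply: dF.
  apply: key => u t; apply: differentiableM; [exact: h4|exact: g4].
- move=> c' s cx'; rewrite lap_sum_map; apply: eq_lap_sum => u t _.
  by rewrite g5 // (h5 c' [:: u]).
Qed.

Definition holo_mx V r q (W : eform X r) : Prop :=
  forall i j, holo_form V q (fun c x s => W c x s i j).

Lemma holo_eprod V r q (W W' : eform X r) : open V ->
  holo_mx V 1 W -> holo_mx V q W' -> holo_mx V q.+1 (eprod W W').
Proof.
move=> oV hW hW' i j.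
pose F l : Defs.form X (CC R) := fun c x s =>
  lap_sum (fun u t => W c x [:: u] i l * W' c x t l j) s.
apply: (@eq_holo_form V q.+1 (fun c x s => \sum_l F l c x s) _ oV).
  move=> c x s Vx cx; rewrite eprod_lap.
    rewrite lap_sum_mxE -(lap_sum_sum _ _ (fun l u t => W c x [:: u] i l * W' c x t l j)).
    by apply: eq_lap_sum => u t _; rewrite mxE.
  move=> t t1; apply/matrixP => a b; rewrite mxE.
  by have [-> //] := hW a b c x Vx cx.
apply: holo_form_sum => l; exact: (holo_form_wedge1 (hW i l) (hW' l j)).
Qed.

Lemma holo_eone V r : holo_mx V 0 (@eone R n X r).
Proof.
move=> i j c x Vx cx; split.
- by case=> [|u s] //= _; rewrite mxE.
- by move=> s1 s2 a u v; case: s1 => [|y s1]; rewrite /eone /= !mxE mulr0 addr0.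
- by move=> s1 s2 s3 u; case: s1 => [|y s1]; rewrite /eone /= !mxE.
- by move=> s; apply: differentiable_cst.
- by move=> c' [|u s].
Qed.

Lemma holo_eprod_big V r k (W : 'I_k -> eform X r) : open V ->
  (forall i, holo_mx V 1 (W i)) ->
  holo_mx V k (\big[@eprod R n X r/@eone R n X r]_(i < k) W i).
Proof.
move=> oV; elim: k W => [|k IH] W hW; first by rewrite big_ord0; apply: holo_eone.
by rewrite big_ord_recl; apply: holo_eprod => //; apply: IH.
Qed.

Lemma holo_etrace V r q (W : eform X r) : holo_mx V q W -> holo_form V q (etrace W).
Proof. by move=> hW; apply: holo_form_sum => i; apply: hW. Qed.

Lemma cech_space_skew (A : Type) (U : A -> set X) p q (b : cochain X A (CC R) p) :
  cech_space U q b -> cech_space U q (cech_skew b).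
Proof.
move=> hb al; apply: holo_formZ; first exact: holo_fun_cst.
apply: holo_form_sum => s; apply: holo_formZ; first exact: holo_fun_cst.
have -> : inter U al = inter U (al \o s); last exact: hb.
apply/seteqP; split=> x Ux i _; first exact: Ux.
by have := Ux (s^-1%g i) I; rewrite /= permKV.
Qed.

End HoloForms.

(** * Frames and connections *)

Section Trans.
Variables (K : fieldType) (vT : vectType K) (r : nat).
Implicit Types (f g : r.-tuple vT).

Definition trans_mx f g : 'M[K]_r := \matrix_(i, j) coord f i (tnth g j).

Lemma basis_coordE f v : basis_of fullv f -> v = \sum_i coord f i v *: tnth f i.
Proof.
move=> bf; rewrite {1}(coord_basis bf (memvf v)); apply: eq_bigr => i _.
by rewrite (tnth_nth 0).
Qed.

Lemma trans_mxK f g : basis_of fullv f -> basis_of fullv g ->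
  trans_mx f g *m trans_mx g f = 1%:M.
Proof.
move=> bf bg; apply/matrixP => i j; rewrite !mxE.
have -> : (i == j)%:R = coord f i (tnth f j).
  by rewrite (tnth_nth 0) coord_free ?(basis_free bf) // eq_sym.
rewrite [in RHS](basis_coordE (tnth f j) bg) linear_sum /=.
by apply: eq_bigr => l _; rewrite !mxE linearZ mulrC.
Qed.

Lemma trans_mx_coord f g v i : basis_of fullv g ->
  coord f i v = \sum_j trans_mx f g i j * coord g j v.
Proof.
move=> bg; rewrite {1}(basis_coordE v bg) linear_sum /=.
by apply: eq_bigr => j _; rewrite mxE linearZ mulrC.
Qed.

End Trans.

Lemma prod_conj (K : comPzRingType) r (P Q : 'M[K]_r) (I : Type) (s : seq I)
    (x : I -> 'M[K]_r) : P *m Q = 1%:M -> Q *m P = 1%:M ->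
  \prod_(i <- s) (P *m x i *m Q) = P *m (\prod_(i <- s) x i) *m Q.
Proof.
move=> PQ QP; elim: s => [|i s IH]; first by rewrite !big_nil mulmx1 PQ.
rewrite !big_cons IH -[_ * (_ *m _)]/(_ *m _) -[x i * _]/(x i *m _) !mulmxA.
by rewrite -(mulmxA _ Q P) QP mulmx1.
Qed.

Section BundleHolo.
Variables (R : realType) (n : nat) (X : complex_manifold R n) (r : nat).
Variable E : holo_bundle X r.
Implicit Types (U V W : set X) (f g : frame E) (s : forall x, E x).

Lemma holo_section_sub V W s : V `<=` W -> holo_section W s -> holo_section V s.
Proof.
by move=> VW hs i a; apply: holo_fun_sub (hs i a) => x [/VW].
Qed.

Lemma holo_frame_sub V W f : V `<=` W -> holo_frame W f -> holo_frame V f.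
Proof.
move=> VW [hf bf]; split=> [j|x /VW]; last exact: bf.
exact: holo_section_sub (hf j).
Qed.

Lemma holo_fun_local V h :
  (forall x, V x -> exists2 W, W x & holo_fun W h) -> holo_fun V (h : X -> CC R).
Proof. by move=> hW c x /hW [W Wx hh]; apply: hh. Qed.

Lemma holo_form_local V q w :
  (forall x, V x -> exists2 W, W x & holo_form W q w) -> holo_form V q w.
Proof. by move=> hW c x /hW [W Wx hh]; apply: hh. Qed.

(** A holomorphic frame is known through its coordinates in the
    trivialisations; the inverse of that matrix is holomorphic by Cramer's
    rule. *)
Lemma trans_triv_holo V f k i a : open V -> holo_frame V f ->
  holo_fun (V `&` triv_dom k) (fun x => trans_mx (f x) (triv_frame k x) i a).
Proof.
move=> oV [hf bf].
have oW : open (V `&` triv_dom k) by apply: openI => //; apply: triv_open.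
have key y : (V `&` triv_dom k) y ->
    trans_mx (triv_frame k y) (f y) *m trans_mx (f y) (triv_frame k y) = 1%:M.
  by case=> Vy ky; apply: trans_mxK; [apply: triv_basis|apply: bf].
have keyE y : (V `&` triv_dom k) y ->
    invmx (trans_mx (triv_frame k y) (f y)) i a = trans_mx (f y) (triv_frame k y) i a.
  move=> Wy; have PQ := key y Wy; have [uP _] := mulmx1_unit PQ.
  by congr (fun_of_matrix _ i a); rewrite -[RHS](mulKmx uP) PQ mulmx1.
apply: (eq_holo_fun oW keyE); apply: holo_fun_invmx => //.
  move=> p q; apply: (holo_fun_ext _ (hf q k p)) => y; by rewrite mxE.
by move=> y Wy; have [] := mulmx1_unit (key y Wy).
Qed.

Lemma holo_coord V f s i : open V -> holo_frame V f -> holo_section V s ->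
  holo_fun V (fun x => coord (f x) i (s x)).
Proof.
move=> oV hf hs; apply: holo_fun_local => x Vx; have [k kx] := triv_cover E x.
have oW : open (V `&` triv_dom k) by apply: openI => //; apply: triv_open.
exists (V `&` triv_dom k) => //.
have E1 y : (V `&` triv_dom k) y ->
    \sum_j trans_mx (f y) (triv_frame k y) i j * coord (triv_frame k y) j (s y) =
    coord (f y) i (s y).
  by case=> Vy ky; rewrite -trans_mx_coord //; apply: triv_basis.
apply: (eq_holo_fun oW E1); apply: holo_fun_sum => j _.
by apply: holo_funM; [exact: trans_triv_holo|exact: hs].
Qed.

Lemma holo_conn_matrix U V f (D : holo_connection E U) : open V -> V `<=` U ->
  holo_frame V f -> holo_mx V 1 (conn_matrix f D).
Proof.
move=> oV VU hf i j; apply: holo_form_local => x Vx; have [k kx] := triv_cover E x.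
have oW : open (V `&` triv_dom k) by apply: openI => //; apply: triv_open.
exists (V `&` triv_dom k) => //.
pose w l : Defs.form X (CC R) := fun c x z =>
  if z is [:: v] then coord (triv_frame k x) l (D (fun y => tnth (f y) j) c x v) else 0.
apply: (@eq_holo_form _ _ _ _ _ (fun c y z =>
  \sum_l trans_mx (f y) (triv_frame k y) i l * w l c y z) _ oW).
  move=> c y [|v [|? ?]] [Vy ky] _ /=.
  - by rewrite big1 ?mxE // => l _; rewrite mulr0.
  - by rewrite mxE -trans_mx_coord //; apply: triv_basis.
  - by rewrite big1 ?mxE // => l _; rewrite mulr0.
apply: holo_form_sum => l; apply: holo_formZ; first exact: trans_triv_holo.
have hD : holo_Eform1 V (D (fun y => tnth (f y) j)) by apply: nabla_holo => //; apply: hf.1.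
exact: (hD k l).
Qed.

Lemma holo_section0 V : holo_section V (fun x => 0 : E x).
Proof.
move=> i a; apply: (holo_fun_ext _ (@holo_fun_cst _ _ _ (V `&` triv_dom i) 0)) => y.
by rewrite linear0.
Qed.

Lemma holo_sectionD V s s' : holo_section V s -> holo_section V s' ->
  holo_section V (fun x => s x + s' x).
Proof.
move=> hs hs' i a; apply: (holo_fun_ext _ (holo_funD (hs i a) (hs' i a))) => y.
by rewrite linearD.
Qed.

Lemma holo_sectionZ V h s : holo_fun V h -> holo_section V s ->
  holo_section V (fun x => h x *: s x).
Proof.
move=> hh hs i a.
apply: (holo_fun_ext _ (holo_funM (holo_fun_sub _ hh) (hs i a))) => [y|].
  by rewrite linearZ.
by move=> x [].
Qed.

Lemma nabla0 U V (D : holo_connection E U) c x v : open V -> V `<=` U -> V x ->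
  in_chart c x -> D (fun x => 0) c x v = 0.
Proof.
move=> oV VU Vx cx; have h0 := @holo_section0 V.
(* nabla 0 = nabla (0 + 0) = nabla 0 + nabla 0. *)
have := nabla_add D oV VU h0 h0 v Vx cx.
rewrite (_ : (fun y => 0 + 0) = fun y => 0 :> E y).
  by move=> /eqP; rewrite -subr_eq0 opprD addNKr oppr_eq0 => /eqP.
by apply: functional_extensionality_dep => y; rewrite addr0.
Qed.

(** The two conclusions are proved together: additivity of the connection
    requires the partial sums to be holomorphic sections. *)
Lemma nabla_lin U V (D : holo_connection E U) (I : Type) (t : seq I)
    (h : I -> X -> CC R) (sec : I -> forall x, E x) c x v :
  open V -> V `<=` U -> V x -> in_chart c x ->
  (forall i, holo_fun V (h i)) -> (forall i, holo_section V (sec i)) ->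
  holo_section V (fun y => \sum_(i <- t) h i y *: sec i y) /\
  D (fun y => \sum_(i <- t) h i y *: sec i y) c x v =
  \sum_(i <- t) (chart_deriv c (h i) x v *: sec i x + h i x *: D (sec i) c x v).
Proof.
move=> oV VU Vx cx hh hs; elim: t => [|i t [IHs IH]].
  rewrite big_nil (_ : (fun y => _) = fun y => 0 :> E y); last first.
    by apply: functional_extensionality_dep => y; rewrite big_nil.
  by split; [exact: holo_section0 | exact: (nabla0 _ _ oV)].
rewrite (_ : (fun y => _) = fun y =>
  h i y *: sec i y + \sum_(l <- t) h l y *: sec l y); last first.
  by apply: functional_extensionality_dep => y; rewrite big_cons.
have h1 := holo_sectionZ (hh i) (hs i).
split; first exact: holo_sectionD.
by rewrite big_cons (nabla_add D oV VU h1 IHs) // (nabla_leibniz D oV VU) // IH.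
Qed.

End BundleHolo.

(** * Change of frame *)

Section FrameChange.
Variables (R : realType) (n : nat) (X : complex_manifold R n).
Variables (A : Type) (U : A -> set X) (r : nat).
Variables (E : holo_bundle X r) (e : A -> frame E).
Variable D : forall a, holo_connection E (U a).
Hypothesis e_frame : forall a, holo_frame (U a) (e a).

(** By the Leibniz rule, both connections produce the same derivatives of the
    transition matrix, and these cancel in the difference. *)
Lemma omega_change V g h a b c x v : open V -> V x -> in_chart c x ->
  V `<=` U g -> V `<=` U h -> V `<=` U a -> V `<=` U b ->
  omega e D h a b c x [:: v] =
  trans_mx (e h x) (e g x) *m omega e D g a b c x [:: v] *m trans_mx (e g x) (e h x).
Proof.
move=> oV Vx cx Vg Vh Va Vb.
have [hg bg] := holo_frame_sub Vg (e_frame g).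
have [hh bh] := holo_frame_sub Vh (e_frame h).
pose T y := trans_mx (e g y) (e h y).
pose sec i y := tnth (e g y) i.
have hT i j : holo_fun V (fun y => T y i j).
  apply: (holo_fun_ext _ (holo_coord i oV (conj hg bg) (hh j))) => y.
  by rewrite /T mxE.
pose nab d i := D d (sec i) c x v.
have nablaE d j : V `<=` U d ->
    D d (fun y => tnth (e h y) j) c x v =
    \sum_i chart_deriv c (fun y => T y i j) x v *: sec i x + \sum_i T x i j *: nab d i.
  move=> Vd; have [hs E1] := @nabla_lin R n X r E (U d) V (D d) 'I_r (index_enum _)
    (fun i y => T y i j) sec c x v oV Vd Vx cx (fun i => hT i j) hg.
  rewrite -big_split /= -E1; apply: (nabla_local (D d) oV Vd (hh j) hs) => // y Vy.
  rewrite [LHS](basis_coordE _ (bg y Vy)); apply: eq_bigr => i _.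
  by rewrite /T mxE.
apply/matrixP => i j; rewrite !mxE !nablaE // -linearB /= opprD addrACA subrr add0r.
rewrite -sumrB linear_sum; apply: eq_bigr => l _ /=.
rewrite -scalerBr linearZ mulrC /=; congr (_ * _).
rewrite !mxE (trans_mx_coord _ _ _ (bg x Vx)); apply: eq_bigr => m _.
by rewrite !mxE linearB.
Qed.
End FrameChange.

(** * The comparison *)

Section Comparison.
Variables (R : realType) (n : nat) (X : complex_manifold R n).
Variables (A : Type) (U : A -> set X) (r : nat).
Variables (E : holo_bundle X r) (e : A -> frame E).
Variable D : forall a, holo_connection E (U a).
Hypothesis e_frame : forall a, holo_frame (U a) (e a).
Hypothesis U_open : forall p (al : 'I_p.+1 -> A), open (inter U al).

(** A change of frame conjugates all the factors by the same matrix. *)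
Lemma tr_prod_omega p (al : 'I_p.+1 -> A) c x (g h : 'I_p.+1) k
    (a b : 'I_k -> 'I_p.+1) (v : 'I_k -> 'rV[CC R]_n) :
  inter U al x -> in_chart c x ->
  \tr (\prod_i omega e D (al h) (al (a i)) (al (b i)) c x [:: v i]) =
  \tr (\prod_i omega e D (al g) (al (a i)) (al (b i)) c x [:: v i]).
Proof.
move=> Ux cx; have sub i : inter U al `<=` U (al i) by move=> y /(_ i I).
pose P := trans_mx (e (al h) x) (e (al g) x).
pose Q := trans_mx (e (al g) x) (e (al h) x).
have bf i : basis_of fullv (e (al i) x) by have [_] := e_frame (al i); apply; apply: sub.
have PQ : P *m Q = 1%:M by apply: trans_mxK; apply: bf.
have QP : Q *m P = 1%:M by apply: trans_mxK; apply: bf.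
have omE i : omega e D (al h) (al (a i)) (al (b i)) c x [:: v i] =
    P *m omega e D (al g) (al (a i)) (al (b i)) c x [:: v i] *m Q.
  by apply: (@omega_change _ _ _ _ _ _ _ e D e_frame (inter U al)) => //; apply: U_open.
rewrite (eq_bigr _ (fun i _ => omE i)).
by rewrite (prod_conj _ _ PQ QP) mxtrace_mulC mulmxA QP mul1mx.
Qed.

(** For a permutation t of the indices, the fibre integral is a sum over the
    permutations q of {1, ..., k}, weighted by sgn q, of star products for t o
    q.  Every q has the same contribution to the skew-symmetrisation, and the
    number k! of them compensates the volume of the simplex.  The star is then
    exchanged for the path by [alt_path_star]. *)
Lemma skew_comparison k (al : 'I_k.+1 -> A) c x s :
  inter U al x -> in_chart c x -> size s = k ->
  cech_skew (bidegree k k (trace_fibre_int e D k)) al c x s =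
  cech_skew (trace_atiyah e D k) al c x s.
Proof.
move=> Ux cx sk; rewrite /cech_skew; congr (_ * _).
pose om (i : 'I_k) (l : 'S_k) (a b : 'I_k.+1) : 'M[CC R]_r :=
  omega e D (al ord0) (al a) (al b) c x [:: nth 0 s (l i)].
have trE (t : 'S_k.+1) (a b : 'I_k -> 'I_k.+1) (l : 'S_k) :
    \tr (\prod_i omega e D (al (t ord0)) (al (a i)) (al (b i)) c x [:: nth 0 s (l i)]) =
    \tr (\prod_i om i l (a i) (b i)).
  exact: (tr_prod_omega ord0 (t ord0) a b (fun i => nth 0 s (l i)) Ux cx).
(* The sum over l evaluates the products of 1-forms at s. *)
pose star_sum (t : 'S_k.+1) := \sum_(l : 'S_k) (-1) ^+ l *
  \tr (\prod_i om i l (t ord0) (t (lift ord0 i))).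
pose path_sum (t : 'S_k.+1) := \sum_(l : 'S_k) (-1) ^+ l *
  \tr (\prod_i om i l (t (widen_ord (leqnSn k) i)) (t (lift ord0 i))).
transitivity (\sum_(t : 'S_k.+1) (-1) ^+ t * star_sum t).
  transitivity (\sum_(t : 'S_k.+1) \sum_(q : 'S_k)
      k`!%:R^-1 * ((-1) ^+ (lift_perm ord0 ord0 q * t)%g * star_sum (lift_perm ord0 ord0 q * t)%g)).
    apply: eq_bigr => t _; rewrite /bidegree sk eqxx /trace_fibre_int /etrace.
    rewrite fibre_int_top // mxtraceZ raddf_sum mulr_sumr mulr_sumr.
    apply: eq_bigr => q _; rewrite mulrCA; congr (_ * _).
    rewrite odd_permM odd_lift_perm /= addbC signr_addb -mulrA; congr (_ * _).
    rewrite raddf_sum mulr_sumr; apply: eq_bigr => l _ /=.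
    rewrite !mxtraceZ; congr (_ * (_ * _)).
    rewrite (trE t (fun=> t ord0) (fun i => t (lift ord0 (q i))) l).
    by congr (\tr _); apply: eq_bigr => i _; rewrite !permM lift_perm_id lift_perm_lift.
  (* Translation by the permutation that extends q absorbs q. *)
  rewrite exchange_big /=.
  rewrite (eq_bigr (fun=> k`!%:R^-1 * \sum_(t : 'S_k.+1) (-1) ^+ t * star_sum t)).
    by rewrite sumr_const card_Sn -[LHS]mulr_natl mulrA divff ?mul1r // pnatr_eq0 -lt0n fact_gt0.
  move=> q _; rewrite mulr_sumr [RHS](reindex_inj (mulgI (lift_perm ord0 ord0 q))).
  exact: eq_bigr.
transitivity (\sum_(t : 'S_k.+1) (-1) ^+ t * path_sum t); last first.
  apply: eq_bigr => t _; congr (_ * _); rewrite /trace_atiyah /etrace atiyah_top //.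
  rewrite raddf_sum; apply: eq_bigr => l _ /=; rewrite mxtraceZ; congr (_ * _).
  by rewrite -(trE t (fun i => t (widen_ord (leqnSn k) i)) (fun i => t (lift ord0 i)) l).
rewrite /star_sum /path_sum; under eq_bigr do rewrite mulr_sumr.
under [RHS]eq_bigr do rewrite mulr_sumr.
rewrite exchange_big [RHS]exchange_big; apply: eq_bigr => l _ /=.
have trS (F : 'S_k.+1 -> 'M[CC R]_r) :
    \sum_(t : 'S_k.+1) (-1) ^+ t * ((-1) ^+ l * \tr (F t)) =
    (-1) ^+ l * \tr (\sum_(t : 'S_k.+1) (-1) ^+ t * F t).
  rewrite raddf_sum mulr_sumr; apply: eq_bigr => t _ /=.
  by rewrite mulrCA; congr (_ * _); case: (odd_perm t); rewrite ?mulN1r ?mul1r ?raddfN.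
rewrite !trS; congr (_ * \tr _); symmetry.
apply: etrans (alt_path_star (fun i a =>
  conn_matrix (e (al ord0)) (D (al a)) c x [:: nth 0 s (l i)])).
by [].
Qed.

End Comparison.

Theorem theorem5p5p1 (R : realType) (n r : nat) (X : complex_manifold R n)
  (X_paracompact : paracompact X)
  (A : Type) (U : A -> set X)
  (U_cover : is_open_cover setT U)
  (U_locally_finite : locally_finite setT U)
  (U_stein : forall p (al : 'I_p.+1 -> A), stein (inter U al))
  (E : holo_bundle X r)
  (e : A -> frame E)
  (e_frame : forall a, holo_frame (U a) (e a))
  (D : forall a, holo_connection E (U a))
  (D_flat : forall a, flat (D a))
  (k : nat) :
  let lhs := cech_skew (bidegree k k (trace_fibre_int e D k)) in
  let rhs := cech_skew (trace_atiyah e D k) in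
  [/\ cech_space U k lhs, cech_space U k rhs & cochain_eq U lhs rhs].
Proof.
move=> lhs rhs.
have U_open p (al : 'I_p.+1 -> A) : open (inter U al) by have [] := U_stein p al.
have eq_skew : cochain_eq U lhs rhs.
  move=> al c x s Ux cx; have [sk|sk] := eqVneq (size s) k.
    exact: skew_comparison.
  rewrite /lhs /rhs /cech_skew; congr (_ * _); apply: eq_bigr => t _; congr (_ * _).
  by rewrite /bidegree (negPf sk) /trace_atiyah /etrace atiyah_size // raddf0.
have rhs_holo : cech_space U k rhs.
  apply: cech_space_skew => al; apply: holo_etrace; apply: holo_eprod_big => // i.
  have sub l : inter U al `<=` U (al l) by move=> y /(_ l I).
  have hm l : holo_mx (inter U al) 1 (conn_matrix (e (al ord0)) (D (al l))).
    by apply: holo_conn_matrix => //; apply: holo_frame_sub (e_frame _).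
  move=> a b.
  have omE c x s : inter U al x -> in_chart c x ->
      conn_matrix (e (al ord0)) (D (al (lift ord0 i))) c x s a b +
      (-1) * conn_matrix (e (al ord0)) (D (al (widen_ord (leqnSn k) i))) c x s a b =
      omega e D (al ord0) (al (widen_ord (leqnSn k) i)) (al (lift ord0 i)) c x s a b.
    by move=> _ _; rewrite !mxE mulN1r.
  apply: (eq_holo_form (U_open _ al) omE).
  apply: holo_formD; first exact: hm.
  by apply: holo_formZ; [exact: holo_fun_cst | exact: hm].
split; [|exact: rhs_holo|exact: eq_skew].
move=> al; apply: (eq_holo_form (U_open _ al) _ (rhs_holo al)) => c x s Ux cx.
by rewrite eq_skew.
Qed.
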